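(* For every integer $k\ge1$ and all partitions $\mu,\nu$: $$G^{\beta}_{(1^k)} G^{\beta}_{\mu/\!\!/\nu} = \sum_{\substack{\lambda:\ \lambda/\mu \text{ vertical strip}\\ \eta \subseteq \nu}} (-1)^{|\lambda/\mu| - k} \beta^{|\lambda/\mu| + |\nu/\eta| - k} \binom{c(\lambda/\mu) + c(\nu/\eta) - 1}{|\lambda/\mu| + c(\nu/\eta) - k}\, G^{\beta}_{\lambda/\!\!/\eta},$$ $$g^{\beta}_{(k)} g^{\beta}_{\mu/\nu} = \sum_{\substack{\lambda/\mu \text{ horizontal strip}\\ \nu/\eta \text{ vertical strip}}} (-1)^{k - |\lambda/\mu|} \beta^{k - |\lambda/\mu| - |\nu/\eta|} \binom{a(\lambda/\!\!/\mu) - a(\nu'/\!\!/\eta') - |\nu/\eta|}{k - |\lambda/\mu| - |\nu/\eta|}\, g^{\beta}_{\lambda/\eta}.$$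
   Context: Partitions are identified with Young diagrams $\{(i,j):1\le j\le\lambda_i\}$ (row $i$, column $j$); $\lambda'$ is the conjugate partition, $|\lambda/\mu|$ the number of boxes of the skew shape $\lambda/\mu$ (for $\mu\subseteq\lambda$), and $c(\lambda/\mu)$ the number of columns containing a box of $\lambda/\mu$. $\lambda/\mu$ is a horizontal (resp. vertical) strip if $\mu\subseteq\lambda$ and no two of its boxes are in the same column (resp. row); the empty shape counts. $I(\mu)$ is the set of removable boxes (inner corners) of $\mu$, and $a(\lambda/\!\!/\mu)$ is the number of boxes of $I(\mu)$ that do not lie in the same column as any box of $\lambda/\mu$. Binomial coefficients $\binom{t}{s}$ are $t(t-1)\cdots(t-s+1)/s!$ for integers $s\ge0$ (any integer $t$) and $0$ for $s<0$. $(1^k)$ denotes the one-column partition with $k$ boxes and $(k)$ the one-row partition. Let $\beta$ be a scalar parameter and $\mathbb{Z}[\beta]P$ the free $\mathbb{Z}[\beta]$-module with basis all partitions, with pairing $\langle\lambda,\mu\rangle=\delta_{\lambda\mu}$. For $i\ge1$, $u_i\cdot\lambda$ adds a box in column $i$ (or gives $0$ if the result is not a partition) and $d_i\cdot\lambda$ removes a box from column $i$ (or gives $0$). Set $\widetilde u_i=u_i(1-\beta d_i)$, $\widetilde d_i=\sum_{k\ge1}\beta^{k-1}d_i^k$, $A(x)=\cdots(1+x\widetilde u_2)(1+x\widetilde u_1)$, $B(x)=(1+x\widetilde d_1)(1+x\widetilde d_2)\cdots$. Define symmetric functions by $G^\beta_{\lambda/\!\!/\mu}(x_1,\dots,x_n)=\langle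 A(x_n)\cdots A(x_1)\cdot\mu,\lambda\rangle$ and $g^\beta_{\lambda/\mu}(x_1,\dots,x_n)=\langle B(x_n)\cdots B(x_1)\cdot\lambda,\mu\rangle$ (symmetric polynomials stable under $x_n=0$, extended to infinitely many variables). Write $G^\beta_\lambda=G^\beta_{\lambda/\!\!/\varnothing}$, $g^\beta_\lambda=g^\beta_{\lambda/\varnothing}$. *)

(* Defs.v *)
From HB Require Import structures.
From mathcomp Require Import all_boot all_order all_algebra finmap.
From mathcomp Require Import boolp classical_sets fsbigop.
From mathcomp Require Import mpoly monalg zify.

Set Implicit Arguments.
Unset Strict Implicit.
Unset Printing Implicit Defensive.

Import GRing.Theory.
Local Open Scope ring_scope.

(* Rows and columns are numbered from 0 throughout: the i-th row (column) of
   the usual 1-based convention has index i - 1 here. *)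

Definition is_part (s : seq nat) : bool := sorted geq s && (0%N \notin s).

Record intpart := IntPart { part_val :> seq nat; _ : is_part part_val }.

HB.instance Definition _ := [isSub for part_val].
HB.instance Definition _ := [Choice of intpart by <:].

Definition boxes (la : intpart) : seq (nat * nat) :=
  [seq (i, j) | i <- iota 0 (size la), j <- iota 0 (nth 0%N la i)].

Definition subpart (mu la : intpart) : bool :=
  all (fun b => b \in boxes la) (boxes mu).

Definition skew (la mu : intpart) : seq (nat * nat) :=
  [seq b <- boxes la | b \notin boxes mu].

Definition skew_size (la mu : intpart) : nat := size (skew la mu).

Definition skew_cols (la mu : intpart) : nat :=
  size (undup [seq b.2 | b <- skew la mu]).

Definition hstrip (la mu : intpart) : bool :=
  subpart mu la && uniq [seq b.2 | b <- skew la mu].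

Definition vstrip (la mu : intpart) : bool :=
  subpart mu la && uniq [seq b.1 | b <- skew la mu].

Definition corners (mu : intpart) : seq (nat * nat) :=
  [seq b <- boxes mu | (b.1.+1, b.2) \notin boxes mu
                     & (b.1, b.2.+1) \notin boxes mu].

(* The statistic written a(la // mu). *)
Definition free_corners (la mu : intpart) : nat :=
  count (fun b => b.2 \notin [seq b'.2 | b' <- skew la mu]) (corners mu).

Definition collen (la : intpart) (j : nat) : nat := count (ltn j) la.

Lemma conj_subproof (la : intpart) :
  is_part (mkseq (collen la) (head 0%N la)).
Proof.
apply/andP; split.
  apply/(sortedP 0%N) => i; rewrite size_mkseq => lti.
  rewrite !nth_mkseq ?(ltnW lti) //.
  by apply: sub_count => x /= /ltnW.
apply/mapP => -[j]; rewrite mem_iota /= add0n => ltj.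
case: la ltj => [[|p s] hs] //= ltj.
by rewrite /collen /= ltj.
Qed.

Definition conj_part (la : intpart) : intpart := IntPart (conj_subproof la).

Lemma nil_subproof : is_part [::]. Proof. by []. Qed.
Definition empty_part : intpart := IntPart nil_subproof.

Lemma one_col_subproof (k : nat) : is_part (nseq k 1%N).
Proof.
apply/andP; split; last by rewrite mem_nseq andbF.
by case: k => [|k] //; elim: k => [|k IH] //=.
Qed.
Definition one_col (k : nat) : intpart := IntPart (one_col_subproof k).

(* nseq (0 < k) k is [:: k] for k >= 1 and [::] for k = 0. *)
Lemma one_row_subproof (k : nat) : is_part (nseq (0 < k)%N k).
Proof. by case: k. Qed.
Definition one_row (k : nat) : intpart := IntPart (one_row_subproof k).

(* The first free box of column j is in row r = collen la j; adding it gives a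
   partition exactly when row r has j boxes. *)
Definition add_box (j : nat) (la : intpart) : option intpart :=
  let r := collen la j in
  if nth 0%N la r == j then insub (incr_nth la r) else None.

(* The last box of column j is in row r = collen la j - 1; it is removable
   exactly when row r has j + 1 boxes (never, if column j is empty). A row that
   becomes empty is the last one and is dropped. *)
Definition rem_box (j : nat) (la : intpart) : option intpart :=
  let r := (collen la j).-1 in
  if nth 0%N la r == j.+1 then insub [seq p <- set_nth 0%N la r j | (0 < p)%N]
  else None.

Lemma ltn_nth_collen (la : intpart) (i j : nat) :
  (j < nth 0 la i)%N = (i < collen la j)%N.
Proof.
case: la => s hp; rewrite /collen /=; case/andP: hp => hs _.
elim: s hs i => [|x s IH] hs i /=; first by rewrite nth_nil ltn0.
have /allP xs := order_path_min (rev_trans leq_trans) hs.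
case: (ltnP j x) => hx.
  case: i => [|i] /=; first by rewrite hx.
  by rewrite IH ?(path_sorted hs).
have -> : count (ltn j) s = 0%N.
  by rewrite (@eq_in_count _ _ pred0) ?count_pred0 // => y /xs /=; lia.
case: i => [|i] /=; first by lia.
case: (ltnP i (size s)) => hi; last by rewrite nth_default.
by have /xs /= := mem_nth 0%N hi; lia.
Qed.

Lemma is_partP (s : seq nat) :
  (forall i, nth 0 s i.+1 <= nth 0 s i)%N -> (0%N \notin s) -> is_part s.
Proof.
by move=> h h0; rewrite /is_part h0 andbT; apply/(sortedP 0%N) => i _; apply: h.
Qed.

Lemma part_nth (la : intpart) i : (nth 0 la i.+1 <= nth 0 la i)%N.
Proof.
case: la => s hp /=; case/andP: hp => /(sortedP 0%N) hs _.
case: (ltnP i.+1 (size s)) => hi; first exact: hs.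
by rewrite nth_default.
Qed.

Lemma part_pos (la : intpart) : 0%N \notin (la : seq nat).
Proof. by case: la => s hp /=; case/andP: hp. Qed.

Lemma add_box_isSome (j : nat) (la : intpart) :
  add_box j la = (nth 0 la (collen la j) == j) :> bool.
Proof.
rewrite /add_box; case: eqP => // hj; rewrite isSome_insub; apply: is_partP.
  move=> i; rewrite !nth_incr_nth; have := part_nth la i.
  have := ltn_nth_collen la i j; have := hj.
  by case: eqP => [<-|_]; case: eqP; lia.
have hr : (collen la j <= size la)%N by apply: count_size.
have h0 := part_pos la.
move: (collen la j) hr h0 => r; elim: (la : seq nat) r => [|x s IH] [|r] //=.
  by move=> _; rewrite !inE !negb_or => /andP[].
by rewrite ltnS !inE !negb_or => hr /andP[-> hs]; apply: IH.
Qed.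

Lemma rem_box_isSome (j : nat) (la : intpart) :
  rem_box j la = (nth 0 la (collen la j).-1 == j.+1) :> bool.
Proof.
rewrite /rem_box; case: eqP => // hj; rewrite isSome_insub /is_part mem_filter andbT.
apply: sorted_filter; first exact: (rev_trans leq_trans).
apply/(sortedP 0%N) => i _; rewrite !nth_set_nth /=.
have := part_nth la i; have := ltn_nth_collen la i.+1 j.
by case: eqP => ?; case: eqP => ?; subst; lia.
Qed.

Lemma count_incr (p : pred nat) (s : seq nat) (r : nat) :
  (r <= size s)%N -> p 0%N = false ->
  (count p (incr_nth s r) + p (nth 0 s r) = count p s + p (nth 0 s r).+1)%N.
Proof.
move=> + p0; elim: s r => [|x s IH] [|r] //=; rewrite ?p0; try lia.
by rewrite ltnS => /IH; lia.
Qed.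

Lemma count_set_nth (p : pred nat) (s : seq nat) (r j : nat) :
  (r < size s)%N ->
  (count p (set_nth 0 s r j) + p (nth 0 s r) = count p s + p j)%N.
Proof.
elim: s r => [|x s IH] [|r] //=; first by lia.
by rewrite ltnS => /IH; lia.
Qed.

Lemma collen_add (j : nat) (la ka : intpart) (i : nat) :
  add_box j la = Some ka -> collen ka i = (collen la i + (i == j))%N.
Proof.
rewrite /add_box; case: eqP => // hj; case: insubP => // k _ vk [<-].
rewrite /collen vk.
have := @count_incr (ltn i) la _ (count_size (ltn j) la) (erefl _).
rewrite -/(collen la j) hj /= !ltnS [(i <= j)%N]leq_eqVlt.
by case: eqP => [->|_] /=; rewrite ?ltnn; lia.
Qed.

Lemma collen_rem (j : nat) (la ka : intpart) (i : nat) :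
  rem_box j la = Some ka -> collen la i = (collen ka i + (i == j))%N.
Proof.
rewrite /rem_box; case: eqP => // hj; case: insubP => // k _ vk [<-].
have ltr : ((collen la j).-1 < size la)%N.
  by rewrite ltnNge; apply/negP => /(nth_default 0%N); rewrite hj.
rewrite /collen vk count_filter.
rewrite (@eq_count _ _ (ltn i)); last first.
  by move=> x /=; case: (ltnP i x) => //= /(leq_ltn_trans (leq0n i)) ->.
have := @count_set_nth (ltn i) la _ j ltr.
rewrite hj /= ltnS [(i <= j)%N]leq_eqVlt.
by case: eqP => [->|_] /=; rewrite ?ltnn; lia.
Qed.

Lemma head_collen (la : intpart) (M : nat) :
  (head 0 la <= M)%N = (collen la M == 0)%N.
Proof.
case: la => [[|p s] hs] //=; rewrite /collen /= leqNgt.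
case: ltnP => //= lepM; rewrite add0n.
case/andP: hs => /= /(order_path_min (rev_trans leq_trans)) /allP ps _.
rewrite (@eq_in_count _ _ pred0) ?count_pred0 // => x /ps /= le_xp.
by rewrite ltnNge (leq_trans le_xp lepM).
Qed.

Section Operators.

Variables (R : comNzRingType) (beta : R).

Local Notation RP := {malg R[intpart]}.

Definition lin_ext (F : intpart -> RP) (v : RP) : RP :=
  \sum_(la <- msupp v) mcoeff la v *: F la.

Definition basis_or0 (o : option intpart) : RP :=
  if o is Some la then << la >> else 0.

Definition u_op (j : nat) : RP -> RP :=
  lin_ext (fun la => basis_or0 (add_box j la)).

Definition d_op (j : nat) : RP -> RP :=
  lin_ext (fun la => basis_or0 (rem_box j la)).

Definition ut_op (j : nat) (v : RP) : RP := u_op j (v - beta *: d_op j v).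

(* d_j ^ k kills la as soon as k exceeds the length of column j. *)
Definition dt_op (j : nat) : RP -> RP :=
  lin_ext (fun la =>
    \sum_(1 <= k < (collen la j).+1) beta ^+ k.-1 *: iter k (d_op j) << la >>).

(* The first N factors (1 + x ut_(N-1)) ... (1 + x ut_0) of A(x). *)
Definition A_op (N : nat) (x : R) (v : RP) : RP :=
  foldl (fun w j => w + x *: ut_op j w) v (iota 0 N).

(* (1 + x dt_0) (1 + x dt_1) ...; the factors beyond the last nonempty column
   act on la as the identity. *)
Definition B_op (x : R) : RP -> RP :=
  lin_ext (fun la =>
    foldr (fun j w => w + x *: dt_op j w) << la >> (iota 0 (head 0%N la))).

Lemma mcoeff_lin_ext (F : intpart -> RP) (v : RP) (ka : intpart)
    (D : {fset intpart}) :
  (msupp v `<=` D)%fset ->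
  mcoeff ka (lin_ext F v) = \sum_(la <- D) mcoeff la v * mcoeff ka (F la).
Proof.
move=> sD; rewrite /lin_ext raddf_sum /=.
rewrite (eq_bigr (fun la => mcoeff la v * mcoeff ka (F la))); last first.
  by move=> la _; rewrite mcoeffZ.
apply: big_fset_incl sD _ => la _ /mcoeff_outdom ->.
by rewrite mul0r.
Qed.

Lemma lin_ext_is_linear (F : intpart -> RP) : linear (lin_ext F).
Proof.
move=> c v w; apply/malgP => ka; rewrite mcoeffD mcoeffZ.
pose D := (msupp v `|` msupp w `|` msupp (c *: v + w))%fset.
have sv : (msupp v `<=` D)%fset.
  exact: fsubset_trans (fsubsetUl _ _) (fsubsetUl _ _).
have sw : (msupp w `<=` D)%fset.
  exact: fsubset_trans (fsubsetUr _ _) (fsubsetUl _ _).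
rewrite (mcoeff_lin_ext _ _ sv) (mcoeff_lin_ext _ _ sw).
rewrite (mcoeff_lin_ext _ _ (fsubsetUr _ _ : (_ `<=` D)%fset)).
rewrite mulr_sumr -big_split /=; apply: eq_bigr => la _.
by rewrite mcoeffD mcoeffZ mulrDl mulrA.
Qed.

HB.instance Definition _ (F : intpart -> RP) :=
  GRing.isLinear.Build R RP RP *:%R (lin_ext F) (lin_ext_is_linear F).

Lemma lin_extU (F : intpart -> RP) (la : intpart) : lin_ext F << la >> = F la.
Proof.
apply/malgP => ka; rewrite (@mcoeff_lin_ext F _ _ [fset la]%fset) ?msuppU_le //.
by rewrite big_seq_fset1 mcoeffUU mul1r.
Qed.

Lemma ut_op_is_linear (j : nat) : linear (ut_op j).
Proof.
move=> c v w; rewrite /ut_op /u_op /d_op -linearP; congr (lin_ext _ _).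
rewrite linearP !scalerDr scalerN !scalerA [beta * c]mulrC opprD.
by rewrite addrACA.
Qed.

HB.instance Definition _ (j : nat) :=
  GRing.isLinear.Build R RP RP *:%R (ut_op j) (ut_op_is_linear j).

Lemma mcoeff_ut (j : nat) (v : RP) (ka : intpart) :
  mcoeff ka (ut_op j v)
  = \sum_(la <- msupp v) mcoeff la v * mcoeff ka (ut_op j << la >>).
Proof.
rewrite {1}[v]monalgE linear_sum raddf_sum /=; apply: eq_bigr => la _.
by rewrite -[mcoeff la v in LHS]mulr1 -mcoeffZ -linearZ;
  congr (mcoeff _ (ut_op _ _)); apply/malgP => k; rewrite mcoeffZ !mcoeffU mulr1 mulrnAr mulr1.
Qed.

Lemma mcoeff_ut_basis0 (j M : nat) (la ka : intpart) :
  (head 0 ka <= M)%N -> (M < head 0 la)%N || (M <= j)%N ->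
  mcoeff ka (ut_op j << la >>) = 0.
Proof.
rewrite head_collen => /eqP hka hM.
have hu l : (forall i, (collen la i <= collen l i + (i == j))%N) ->
    mcoeff ka (u_op j (basis_or0 (Some l))) = 0.
  move=> hl; rewrite /u_op /= lin_extU; case E: (add_box j l) => [k|] /=; last first.
    by rewrite mcoeff0.
  rewrite mcoeffU; case: eqP => // ek; exfalso; subst k.
  case/orP: hM => hM.
    move: hM (hl M); rewrite ltnNge head_collen.
    by have := collen_add M E; lia.
  have : (collen ka j <= collen ka M)%N by apply: sub_count => x /=; lia.
  by have := collen_add j E; rewrite eqxx; lia.
rewrite /ut_op /u_op linearB linearZ /= mcoeffB mcoeffZ.
rewrite (hu la) ?sub0r; last by move=> i; apply: leq_addr.
rewrite /d_op lin_extU; case E: (rem_box j la) => [l|] /=; last first.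
  by rewrite linear0 mcoeff0 mulr0 oppr0.
rewrite -[<< l >>]/(basis_or0 (Some l)) -/(u_op j _) hu ?mulr0 ?oppr0 // => i.
by rewrite (collen_rem i E).
Qed.

(* [agree M v w]: v and w have the same coefficients on the partitions with at
   most M columns. *)
Let agree (M : nat) (v w : RP) : Prop :=
  forall la : intpart, (head 0 la <= M)%N -> mcoeff la v = mcoeff la w.

Lemma agree_ut (M j : nat) (v w : RP) :
  agree M v w -> agree M (ut_op j v) (ut_op j w).
Proof.
move=> vw ka hka; apply/eqP; rewrite -subr_eq0 -mcoeffB -linearB mcoeff_ut.
apply/eqP/big1 => la _; case: (leqP (head 0%N la) M) => hla.
  by rewrite mcoeffB vw // subrr mul0r.
by rewrite (@mcoeff_ut_basis0 _ M) ?hla ?mulr0.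
Qed.

Lemma agree_A (M N : nat) (x : R) (v w : RP) :
  (M <= N)%N -> agree M v w -> agree M (A_op N x v) (A_op M x w).
Proof.
move=> /subnKC <-; rewrite /A_op iotaD foldl_cat add0n.
have dz (z y : RP) ka : mcoeff ka (z + x *: y) = mcoeff ka z + x * mcoeff ka y.
  by rewrite mcoeffD mcoeffZ.
have step j v' w' : agree M v' w' ->
    agree M (v' + x *: ut_op j v') (w' + x *: ut_op j w').
  move=> h ka hka; apply: etrans (dz _ _ _) (etrans _ (esym (dz _ _ _))).
  exact: (congr2 +%R (h ka hka) (congr1 ( *%R x) (@agree_ut M j _ _ h ka hka))).
move=> vw; have : agree M (foldl (fun w j => w + x *: ut_op j w) v (iota 0 M))
                      (foldl (fun w j => w + x *: ut_op j w) w (iota 0 M)).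
  elim: (iota 0 M) v w vw => [|j s IH] v' w' h; first exact: h.
  exact: (IH _ _ (step j _ _ h)).
move: (foldl _ v _) (foldl _ w _) => v' w'.
have : {in iota M (N - M), forall j, (M <= j)%N}.
  by move=> j; rewrite mem_iota => /andP[].
elim: (iota M (N - M)) v' => [|j s IH] v' hs vw'; first exact: vw'.
apply: (IH (v' + x *: ut_op j v')).
  by move=> i hi; apply: (hs i); rewrite inE hi orbT.
move=> ka hka; apply: etrans (dz _ _ _) _.
rewrite mcoeff_ut big1 ?mulr0 ?addr0; first exact: vw'.
move=> la _; rewrite (@mcoeff_ut_basis0 _ M) ?mulr0 //.
by rewrite hs ?orbT ?inE ?eqxx.
Qed.

Lemma A_op_stable (n N : nat) (x : 'I_n -> R) (v : RP) (la : intpart) :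
  (head 0 la <= N)%N ->
  mcoeff la (foldl (fun w i => A_op N (x i) w) v (enum 'I_n))
  = mcoeff la (foldl (fun w i => A_op (head 0%N la) (x i) w) v (enum 'I_n)).
Proof.
move=> leN; suff H s v1 v2 : agree (head 0%N la) v1 v2 ->
    agree (head 0%N la) (foldl (fun w i => A_op N (x i) w) v1 s)
      (foldl (fun w i => A_op (head 0%N la) (x i) w) v2 s).
  by apply: H (leqnn _).
elim: s v1 v2 => [|i s IH] v1 v2 h12; first exact: h12.
exact: (IH _ _ (agree_A (x i) leN h12)).
Qed.

End Operators.

(* Z[beta][x_0, ..., x_(n-1)], with beta the variable 'X of {poly int}. *)
Notation Zbx n := {mpoly {poly int}[n]}.

(* < A(x_(n-1)) ... A(x_0) mu, la > with each A cut after N factors. *)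
Definition G_cut (N n : nat) (la mu : intpart) : Zbx n :=
  mcoeff la
    (foldl (fun v (i : 'I_n) => A_op (mpolyC n 'X) N 'X_i v)
           << mu >> (enum 'I_n)).

Lemma G_cut_stable (N n : nat) (la mu : intpart) :
  (head 0 la <= N)%N -> G_cut N n la mu = G_cut (head 0%N la) n la mu.
Proof. by move=> leN; rewrite /G_cut; apply: A_op_stable. Qed.

(* By G_cut_stable, the factors of A beyond the columns of la do not contribute
   to the coefficient of la. As a symmetric function in infinitely many
   variables, G_(la // mu) is the family of its restrictions G n la mu to n
   variables, n : nat; likewise for g below. *)
Definition G (n : nat) (la mu : intpart) : Zbx n := G_cut (head 0%N la) n la mu.

Definition g (n : nat) (la mu : intpart) : Zbx n :=
  mcoeff mu
    (foldl (fun v (i : 'I_n) => B_op (mpolyC n 'X) 'X_i v)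
           << la >> (enum 'I_n)).

(* t (t - 1) ... (t - s + 1) / s! (the division is exact), and 0 for s < 0. *)
Definition binz (t s : int) : int :=
  if s is Posz m then ((\prod_(i < m) (t - i%:Z)) %/ (m`!)%:Z)%Z else 0.

(* A power of beta whose exponent would be negative comes with a vanishing
   binomial coefficient (note skew_cols nu eta <= skew_size nu eta), so the
   truncated subtraction in the exponents of 'X is harmless. For the same
   reason only finitely many la have a nonzero coefficient: one needs
   skew_size la mu < k + skew_cols la mu with skew_cols la mu bounded by the
   number of columns of mu plus 1 in the first case, and skew_size la mu <= k
   in the second. *)
Definition G_pieri_coef (k : nat) (la mu nu eta : intpart) : {poly int} :=
  let s := skew_size la mu in
  ((-1) ^ (s%:Z - k%:Z)
     * binz ((skew_cols la mu)%:Z + (skew_cols nu eta)%:Z - 1)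
            (s%:Z + (skew_cols nu eta)%:Z - k%:Z))%:P
  * 'X^(s + skew_size nu eta - k).

Definition g_pieri_coef (k : nat) (la mu nu eta : intpart) : {poly int} :=
  let s := skew_size la mu in
  let t := skew_size nu eta in
  ((-1) ^ (k%:Z - s%:Z)
     * binz ((free_corners la mu)%:Z
               - (free_corners (conj_part nu) (conj_part eta))%:Z - t%:Z)
            (k%:Z - s%:Z - t%:Z))%:P
  * 'X^(k - s - t).

(* Main.v *)
Require Import Defs.
From mathcomp Require Import all_boot all_order all_algebra finmap.
From mathcomp Require Import boolp classical_sets fsbigop.
From mathcomp Require Import mpoly monalg.
From HB Require Import structures.
From mathcomp Require Import zify ring qpoly.
(* Imported again because all_algebra has a notation [skew] of its own. *)
Require Import Defs.

(** Conjugating the multivariable operator A(x_n)...A(x_1) by B(y) multiplies it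
    by prod_i (1 - x_i y), since A(x) B(y) = (1 - x y) B(y) A(x). In terms of the
    operators U_j = u_j (1 - beta d_j), D_j = d_j / (1 - beta d_j) and the
    projection T_j on the partitions whose columns j-1 and j have the same
    length, this relation, cut after N columns, reads
      A B = B (1 - x y T_N) A,
    and is proved by adding columns one at a time, from N-1 down to 0.

    All operators are products of operators acting on one column each, so the
    entries of A, B and of their inverses factor over columns. They are
      B(y) (nu -> eta) = y^c beta^(|nu/eta| - c),                eta in nu;
      B(beta - t)^-1 (la -> mu) = (t - beta)^c t^(|la/mu| - c),  vertical strip;
      A(w) (mu -> la) = w^|la/mu| (1 - beta w)^a,                horizontal strip;
      A(w)^-1 (eta -> nu) = (-w)^|nu/eta| (1 - beta w)^-(|nu/eta| + a'),
                                                                 vertical strip.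
    Hence B(beta - t)^-1 A..A B(beta - t) = prod_i (1 - x_i (beta - t)) A..A,
    compared with its own instance mu = nu = empty and divided by 1 - beta/t, is
    the generating function in t^k of the first family of identities, and
    A(w)^-1 B..B A(w) = prod_i (1 - x_i w)^-1 B..B is that of the second one in
    w^k. The latter is handled over a ring where w is nilpotent, which makes all
    sums finite and 1 - beta w invertible. *)

Set Implicit Arguments.
Unset Strict Implicit.
Unset Printing Implicit Defensive.

Import GRing.Theory.

#[local] Arguments binz : simpl never.

(** * Partitions by column lengths *)

Lemma collen_nth (la : intpart) i j : (i < collen la j)%N = (j < nth 0 la i)%N.
Proof. by rewrite ltn_nth_collen. Qed.

Lemma collen_le (la : intpart) i j : (i <= j)%N -> (collen la j <= collen la i)%N.
Proof. by move=> leij; apply: sub_count => x /=; apply: leq_ltn_trans. Qed.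

Lemma collenS (la : intpart) j : (collen la j.+1 <= collen la j)%N.
Proof. exact: collen_le. Qed.

Lemma collen0 (la : intpart) j : (head 0 la <= j)%N -> collen la j = 0%N.
Proof. by rewrite head_collen => /eqP. Qed.

Lemma collen_empty j : collen empty_part j = 0%N.
Proof. by []. Qed.

Lemma part_eq (s t : seq nat) : 0%N \notin s -> 0%N \notin t ->
  (forall i, nth 0 s i = nth 0 t i) -> s = t.
Proof.
elim: s t => [|x s IH] [|y t] //=.
- by move=> _ h /(_ 0%N) /= e; rewrite -e inE eqxx in h.
- by move=> h _ /(_ 0%N) /= e; rewrite e inE eqxx in h.
rewrite !inE !negb_or => /andP[_ hs] /andP[_ ht] h.
by rewrite (h 0%N : x = y) (IH t) // => i; apply: (h i.+1).
Qed.

(** The inequalities [j < nth 0 la i] hold for the same [j] as those for [ka]; taking [j] equal to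
    either part compares the two parts. Equality of partitions can thus be checked column by
    column. *)
Lemma collen_inj (la ka : intpart) : collen la =1 collen ka -> la = ka.
Proof.
move=> h; apply/val_inj/part_eq; rewrite ?part_pos // => i /=.
have hlt j : (j < nth 0 la i)%N = (j < nth 0 ka i)%N by rewrite -!collen_nth h.
by have := hlt (nth 0%N la i); have := hlt (nth 0%N ka i); rewrite !ltnn; lia.
Qed.

Lemma nth_conj (la : intpart) j : nth 0 (conj_part la) j = collen la j.
Proof.
rewrite /=; case: (ltnP j (head 0%N la)) => hj; first by rewrite nth_mkseq.
by rewrite nth_default ?size_mkseq // collen0.
Qed.

Lemma collen_conj (la : intpart) i : collen (conj_part la) i = nth 0 la i.
Proof.
have hlt j : (j < collen (conj_part la) i)%N = (j < nth 0 la i)%N.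
  by rewrite collen_nth nth_conj -collen_nth.
have := hlt (nth 0%N la i); have := hlt (collen (conj_part la) i).
by rewrite !ltnn; lia.
Qed.

(** The nonzero values of [c] occupy an initial segment and form a partition; its conjugate has them
    as column lengths. *)
Lemma part_of_cols (c : nat -> nat) N :
  (forall j, c j.+1 <= c j)%N -> (forall j, (N <= j)%N -> c j = 0%N) ->
  exists la : intpart, collen la =1 c.
Proof.
move=> cS c0.
have cle i j : (i <= j -> c j <= c i)%N.
  by move=> /subnKC <-; elim: (j - i)%N => [|m IH]; rewrite ?addn0 // addnS (leq_trans (cS _)).
have [m leM hm] : exists2 m, (m <= N)%N & forall j, (0 < c j)%N = (j < m)%N.
  have hex : exists m, c m == 0%N by exists N; rewrite c0.
  case: (ex_minnP hex) => m /eqP cm0 hmin; exists m.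
    by apply: hmin; rewrite c0.
  move=> j; case: (ltnP j m) => hj; last by have := cle _ _ hj; lia.
  by rewrite lt0n; apply/negP => /hmin; lia.
have hp : is_part (mkseq c m).
  apply/andP; split.
    apply/(sortedP 0%N) => i; rewrite size_mkseq => lti.
    by rewrite !nth_mkseq ?(ltnW lti) //=; apply: cS.
  by apply/mapP => -[j]; rewrite mem_iota /= add0n -hm => + e; rewrite -e.
exists (conj_part (IntPart hp)) => j; rewrite collen_conj /=.
case: (ltnP j m) => hj; first by rewrite nth_mkseq.
by rewrite nth_default ?size_mkseq //; have := hm j; lia.
Qed.

(** * Boxes, strips and corners in terms of column lengths *)

Lemma mem_boxes (la : intpart) i j : ((i, j) \in boxes la) = (i < collen la j)%N.
Proof.
rewrite collen_nth; apply/allpairsPdep/idP => [[i' [j' [+ + [-> ->]]]]|hj].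
  by rewrite !mem_iota.
exists i, j; split; rewrite ?mem_iota //=.
by rewrite ltnNge; apply/negP => /(nth_default 0%N) e; rewrite e in hj.
Qed.

Lemma boxes_uniq (la : intpart) : uniq (boxes la).
Proof.
apply: allpairs_uniq_dep => [|i _|]; rewrite ?iota_uniq //.
by move=> [a b] [c d] _ _ /= [-> ->].
Qed.

Lemma mem_skew (la mu : intpart) i j :
  ((i, j) \in skew la mu) = (collen mu j <= i < collen la j)%N.
Proof. by rewrite mem_filter !mem_boxes -leqNgt. Qed.

Lemma skew_uniq (la mu : intpart) : uniq (skew la mu).
Proof. exact/filter_uniq/boxes_uniq. Qed.

Lemma subpartP (mu la : intpart) :
  reflect (forall j, collen mu j <= collen la j)%N (subpart mu la).
Proof.
apply: (iffP allP) => [h j|h [i j]]; last first.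
  by rewrite !mem_boxes => /leq_trans; apply.
case e: (collen mu j) => [//|m].
by have := h (m, j); rewrite !mem_boxes e; apply.
Qed.

(** Listing boxes column by column turns the statistics of a skew shape into sums over columns. Any
    bound [N] is allowed, so that several shapes can share one range. *)
Lemma perm_skew (la mu : intpart) N : (head 0 la <= N)%N ->
  perm_eq (skew la mu)
    [seq (i, j) | j <- iota 0 N, i <- iota (collen mu j) (collen la j - collen mu j)].
Proof.
move=> hN; apply: uniq_perm; first exact: skew_uniq.
  apply: allpairs_uniq_dep => [|i _|]; rewrite ?iota_uniq //.
  by move=> [a b] [c d] _ _ /= [-> ->].
move=> [i j]; rewrite mem_skew; apply/idP/allpairsPdep => [h|].
  exists j, i; rewrite !mem_iota; split=> //; last by lia.
  by rewrite /= add0n ltnNge; apply/negP => hj; have := collen0 (leq_trans hN hj); lia.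
by case=> [j' [i' [+ + [-> ->]]]]; rewrite !mem_iota; lia.
Qed.

Lemma sum_nat_of_bool (T : Type) (s : seq T) (a : pred T) :
  (\sum_(j <- s) a j)%N = count a s.
Proof. by rewrite -sumn_count sumnE big_map. Qed.

Lemma skew_sizeE (la mu : intpart) N : (head 0 la <= N)%N ->
  skew_size la mu = (\sum_(j <- iota 0 N) (collen la j - collen mu j))%N.
Proof.
move=> hN; rewrite /skew_size (perm_size (perm_skew mu hN)) size_allpairs_dep sumnE big_map.
by apply: eq_bigr => j _; rewrite size_iota.
Qed.

Lemma skew_colsE (la mu : intpart) N : (head 0 la <= N)%N ->
  skew_cols la mu = (\sum_(j <- iota 0 N) (collen mu j < collen la j))%N.
Proof.
move=> hN; rewrite /skew_cols sum_nat_of_bool -size_filter.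
apply/perm_size/uniq_perm; rewrite ?undup_uniq ?filter_uniq ?iota_uniq // => j.
rewrite mem_undup mem_filter mem_iota; apply/mapP/idP => [[[i j'] + /= ->]|/andP[h _]].
  rewrite mem_skew => h; apply/andP; split; first by lia.
  by rewrite /= add0n ltnNge; apply/negP => hj; have := collen0 (leq_trans hN hj); lia.
by exists (collen mu j, j) => //; rewrite mem_skew; lia.
Qed.

Lemma uniq_map_injP (T1 T2 : eqType) (f : T1 -> T2) (s : seq T1) : uniq s ->
  reflect {in s &, injective f} (uniq (map f s)).
Proof.
move=> us; apply: (iffP idP) => [|/map_inj_in_uniq -> //].
elim: s us => [|a s IH] //= /andP[has us] /andP[hfa hu] x y.
rewrite !inE => /orP[/eqP->|hx] /orP[/eqP->|hy] // e.
- by case/negP: hfa; rewrite e map_f.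
- by case/negP: hfa; rewrite -e map_f.
exact: IH.
Qed.

Lemma hstripP (la mu : intpart) :
  reflect (forall j, collen mu j <= collen la j <= (collen mu j).+1)%N (hstrip la mu).
Proof.
apply: (iffP andP) => [[/subpartP hs /(uniq_map_injP _ (skew_uniq _ _)) hi] j|h].
  rewrite hs /=; rewrite leqNgt; apply/negP => hj.
  have [] : (collen mu j, j) = ((collen mu j).+1, j); last by lia.
  by apply: hi => //; rewrite mem_skew; lia.
split; first by apply/subpartP => j; case/andP: (h j).
apply/(uniq_map_injP _ (skew_uniq _ _)) => -[i j] [i' j']; rewrite !mem_skew => + + /= e.
by move: (h j); rewrite -e => *; congr pair; lia.
Qed.

(** By monotonicity of column lengths, two boxes in one row force two such boxes in adjacent
    columns, so only columns [j] and [j.+1] have to be compared. *)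
Lemma vstripP (la mu : intpart) :
  reflect (forall j, collen mu j <= collen la j /\ collen la j.+1 <= collen mu j)%N
          (vstrip la mu).
Proof.
apply: (iffP andP) => [[/subpartP hs /(uniq_map_injP _ (skew_uniq _ _)) hi] j|h].
  split; rewrite ?hs // leqNgt; apply/negP => hj.
  have [] : (collen mu j, j) = (collen mu j, j.+1); last by lia.
  by apply: hi => //; rewrite mem_skew; have := collenS la j; have := collenS mu j; lia.
split; first by apply/subpartP => j; case: (h j).
apply/(uniq_map_injP _ (skew_uniq _ _)) => -[i j] [i' j'] + + /= e; rewrite -{i'}e !mem_skew => h1 h2.
have H a b : (a < b)%N -> (collen mu a <= i)%N -> (i < collen la b)%N -> False.
  by move=> lab; case: (h a) => _; have := collen_le la lab; lia.
case: (ltngtP j j') => [lt|lt|->] //; exfalso; apply: (H _ _ lt); lia.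
Qed.

Lemma mem_corners (mu : intpart) i j :
  ((i, j) \in corners mu) = (i.+1 == collen mu j) && (collen mu j.+1 < collen mu j)%N.
Proof. by rewrite mem_filter !mem_boxes /=; have := collenS mu j; lia. Qed.

Lemma perm_corners (mu : intpart) N : (head 0 mu <= N)%N ->
  perm_eq (corners mu)
    [seq ((collen mu j).-1, j) | j <- iota 0 N & (collen mu j.+1 < collen mu j)%N].
Proof.
move=> hN; apply: uniq_perm; first exact/filter_uniq/boxes_uniq.
  by rewrite map_inj_uniq ?filter_uniq ?iota_uniq // => a b [_ ->].
move=> [i j]; rewrite mem_corners; apply/idP/mapP => [/andP[/eqP hi hj]|[j' + [-> ->]]].
  exists j; rewrite -?hi // mem_filter hj mem_iota /= add0n ltnNge.
  by apply/negP => h; have := collen0 (leq_trans hN h); lia.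
by rewrite mem_filter; lia.
Qed.

Lemma free_cornersE (la mu : intpart) N : (head 0 mu <= N)%N -> subpart mu la ->
  free_corners la mu
  = (\sum_(j <- iota 0 N) ((collen mu j.+1 < collen mu j) && (collen la j == collen mu j)))%N.
Proof.
move=> hN /subpartP hs; rewrite /free_corners (permP (perm_corners hN)) count_map count_filter.
rewrite sum_nat_of_bool; apply: eq_count => j /=; rewrite andbC; congr (_ && _).
apply/idP/eqP => [/mapP h|e].
  apply/eqP; rewrite eqn_leq hs andbT leqNgt; apply/negP => lt; apply: h.
  by exists (collen mu j, j) => //; rewrite mem_skew leqnn.
by apply/mapP => -[[i j'] + /= ej]; rewrite -ej mem_skew; lia.
Qed.

(** After transposition, the corner of [eta] in column [j] counts when its row [(collen eta j).-1]
    has no box of [nu/eta], that is, when this row of [nu] stops before column [j.+1]. The resulting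
    inequality already implies that column [j] of [eta] has a corner. *)
Lemma free_corners_conjE (nu eta : intpart) N : (head 0 eta <= N)%N -> subpart eta nu ->
  free_corners (conj_part nu) (conj_part eta)
  = (\sum_(j <- iota 0 N) (collen nu j.+1 < collen eta j))%N.
Proof.
move=> hN /subpartP hs.
have hp : perm_eq (corners (conj_part eta)) [seq (b.2, b.1) | b <- corners eta].
  apply: uniq_perm; first exact/filter_uniq/boxes_uniq.
    by rewrite map_inj_uniq ?filter_uniq ?boxes_uniq // => -[a b] [c d] [-> ->].
  move=> [i j]; rewrite (map_inj_in_uniq, mem_corners) !collen_conj.
  have -> : ((i, j) \in [seq (b.2, b.1) | b <- corners eta]) = ((j, i) \in corners eta).
    apply/mapP/idP => [[[a b] + [-> ->]] //|h]; by exists (j, i).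
  rewrite mem_corners.
  have := collen_nth eta j i; have := collen_nth eta j.+1 i.
  have := collen_nth eta j i.+1; have := collen_nth eta j.+1 i.+1; have := collenS eta i.
  lia.
rewrite /free_corners (permP hp) (count_map (fun b => (b.2, b.1))).
rewrite (permP (perm_corners hN)) count_map count_filter.
rewrite sum_nat_of_bool; apply: eq_count => j /=.
have -> : ((collen eta j).-1 \notin [seq b'.2 | b' <- skew (conj_part nu) (conj_part eta)])
   = (nth 0 nu (collen eta j).-1 <= nth 0 eta (collen eta j).-1)%N.
  apply/idP/idP => [/mapP h|h]; last first.
    by apply/mapP => -[[i r] + /= e]; rewrite -e mem_skew !collen_conj; lia.
  rewrite leqNgt; apply/negP => lt; apply: h.
  exists (nth 0 eta (collen eta j).-1, (collen eta j).-1)%N => //.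
  by rewrite mem_skew !collen_conj leqnn.
have := collen_nth eta (collen eta j).-1 j; have := collen_nth eta (collen eta j).-1 j.+1.
have := collen_nth nu (collen eta j).-1 j.+1; have := collenS eta j; have := hs j.+1; lia.
Qed.

(** * Adding and removing a box in terms of column lengths *)

Lemma add_boxP (j : nat) (la ka : intpart) :
  add_box j la = Some ka <-> forall i, collen ka i = (collen la i + (i == j))%N.
Proof.
split=> [h i|h]; first exact: collen_add.
have : add_box j la.
  rewrite add_box_isSome eqn_leq; apply/andP; split.
    by rewrite leqNgt -collen_nth ltnn.
  case: j h => // j h; rewrite -[(_ <= _)%N]/(j < _)%N -collen_nth.
  have := h j; have := h j.+1; rewrite eqxx (ltn_eqF (ltnSn j)); have := collenS ka j.
  by lia.
case e: (add_box j la) => [l|] // _; congr Some; apply: collen_inj => i.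
by rewrite (collen_add i e) h.
Qed.

Lemma rem_boxP (j : nat) (la ka : intpart) :
  rem_box j la = Some ka <-> forall i, collen la i = (collen ka i + (i == j))%N.
Proof.
split=> [h i|h]; first exact: collen_rem.
have : rem_box j la.
  rewrite rem_box_isSome -[nth 0%R _ _]/(nth 0%N la _).
  have := h j; have := h j.+1; rewrite eqxx (gtn_eqF (ltnSn j)).
  have := collenS ka j; have := collen_nth la (collen la j).-1 j.
  have := collen_nth la (collen la j).-1 j.+1; lia.
case e: (rem_box j la) => [l|] // _; congr Some; apply: collen_inj => i.
by have := collen_rem i e; rewrite h; lia.
Qed.

Lemma add_box_ex (j : nat) (la : intpart) :
  (add_box j la : bool) = (j == 0%N) || (collen la j < collen la j.-1)%N.
Proof.
rewrite add_box_isSome -[nth 0%R _ _]/(nth 0%N la _); have := collen_nth la (collen la j) j.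
case: j => [|j] /=; first by lia.
by have := collen_nth la (collen la j.+1) j; lia.
Qed.

Lemma rem_box_ex (j : nat) (la : intpart) :
  (rem_box j la : bool) = (collen la j.+1 < collen la j)%N.
Proof.
rewrite rem_box_isSome -[nth 0%R _ _]/(nth 0%N la _); have := collen_nth la (collen la j).-1 j.
have := collen_nth la (collen la j).-1 j.+1; have := collenS la j; lia.
Qed.

(** Every column of [la] beyond those of [mu] contains a box of the skew shape. *)
Lemma skew_size_head (la mu : intpart) : (head 0 la - head 0 mu <= skew_size la mu)%N.
Proof.
case: (leqP (head 0%N la) (head 0%N mu)) => [|h]; first by lia.
rewrite (skew_sizeE mu (leqnn (head 0%N la))).
rewrite (_ : iota 0 (head 0%N la)
  = iota 0 (head 0%N mu) ++ iota (head 0%N mu) (head 0%N la - head 0%N mu)); last first.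
  by rewrite -[X in _ ++ iota X _]add0n -iotaD subnKC // ltnW.
rewrite big_cat /= -[X in (X <= _)%N](size_iota (head 0%N mu)) -sum1_size.
apply: leq_trans (leq_addl _ _).
rewrite big_seq [X in (_ <= X)%N]big_seq; apply: leq_sum => j; rewrite mem_iota => hj.
have hj0 : (0 < collen la j)%N by rewrite lt0n -head_collen -ltnNge; lia.
by rewrite (@collen0 mu j); lia.
Qed.

(** * The box operators and their relations *)

Local Open Scope ring_scope.

(* Projection on the partitions whose columns j - 1 and j have the same length,
   that is, those to which no box can be added in column j. *)
Definition full_op (R : comNzRingType) (j : nat) : {malg R[intpart]} -> {malg R[intpart]} :=
  lin_ext (fun la => if (0 < j)%N && (collen la j.-1 == collen la j) then << la >> else 0).

Section Coef.
Variable R : comNzRingType.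
Implicit Types v w : {malg R[intpart]}.
Definition coef (k : intpart) v : R := mcoeff k v.
Lemma coef_ext v w :
  (forall k, exists p q, [/\ coef k v = p, coef k w = q & p = q]) -> v = w.
Proof.
by move=> h; apply/malgP => k; have [p [q [hp hq e]]] := h k; rewrite -/(coef k v) hp e.
Qed.
Lemma coef_add k v w p q : coef k v = p -> coef k w = q -> coef k (v + w) = p + q.
Proof. by move=> <- <-; apply: mcoeffD. Qed.
Lemma coef_opp k v p : coef k v = p -> coef k (- v) = - p.
Proof. by move=> <-; apply: mcoeffN. Qed.
Lemma coef_scale k c v p : coef k v = p -> coef k (c *: v) = c * p.
Proof. by move=> <-; apply: mcoeffZ. Qed.
Lemma coef_zero k : coef k (0 : {malg R[intpart]}) = 0.
Proof. exact: mcoeff0. Qed.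
End Coef.

(* [mring] proves linear identities between vectors coefficientwise. The
   operators are abstracted first, and the coefficients are expanded by syntactic
   matching, to keep unification from unfolding them. *)
Ltac gen_term t := let x := fresh "x" in generalize t; intro x.
Ltac expand_coef :=
  lazymatch goal with
  | |- coef _ (_ + _)%R = _ => eapply coef_add; expand_coef
  | |- coef _ (- _)%R = _ => eapply coef_opp; expand_coef
  | |- coef _ (_ *: _)%R = _ => eapply coef_scale; expand_coef
  | |- coef _ 0%R = _ => eapply coef_zero
  | |- _ => reflexivity
  end.
Ltac mring :=
  rewrite /=;
  repeat match goal with |- context [?t] => lazymatch t with
    | u_op _ _ => gen_term t | d_op _ _ => gen_term t
    | ut_op _ _ _ => gen_term t | dt_op _ _ _ => gen_term t
    | full_op _ _ => gen_term t
  end end;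
  apply: coef_ext => ?; eexists; eexists; split; [expand_coef | expand_coef |];
  repeat match goal with |- context [?t] =>
    lazymatch t with coef _ _ => gen_term t end end;
  ring.

Section Ops.

Variables (R : comNzRingType) (beta : R).

Local Notation RP := {malg R[intpart]}.

HB.instance Definition _ (j : nat) :=
  GRing.isLinear.Build R RP RP *:%R (@u_op R j) (lin_ext_is_linear _).
HB.instance Definition _ (j : nat) :=
  GRing.isLinear.Build R RP RP *:%R (@d_op R j) (lin_ext_is_linear _).
HB.instance Definition _ (j : nat) :=
  GRing.isLinear.Build R RP RP *:%R (dt_op beta j) (lin_ext_is_linear _).

Local Notation u := (@u_op R).
Local Notation d := (@d_op R).
Local Notation U := (ut_op beta).
Local Notation D := (dt_op beta).

HB.instance Definition _ (j : nat) :=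
  GRing.isLinear.Build R RP RP *:%R (@full_op R j) (lin_ext_is_linear _).
Local Notation T := (@full_op R).

Lemma malg_basis (v : RP) : v = \sum_(la <- msupp v) mcoeff la v *: << la >>.
Proof.
rewrite {1}[v]monalgE; apply: eq_bigr => la _.
by apply/malgP => k; rewrite mcoeffZ !mcoeffU mulr_natr.
Qed.

Lemma basis_eq (la ka : intpart) : collen la =1 collen ka -> << la >> = << ka >> :> RP.
Proof. by move/collen_inj->. Qed.

Lemma eq_lin (f g : RP -> RP) : linear f -> linear g ->
  (forall la, f << la >> = g << la >>) -> f =1 g.
Proof.
move=> lf lg fg v.
pose F : {linear RP -> RP} := HB.pack f (GRing.isLinear.Build R RP RP *:%R f lf).
pose H : {linear RP -> RP} := HB.pack g (GRing.isLinear.Build R RP RP *:%R g lg).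
rewrite -[f]/(F : RP -> RP) -[g]/(H : RP -> RP) [v]malg_basis !linear_sum.
by apply: eq_bigr => la _; rewrite !linearZ /= fg.
Qed.

Variant u_spec (j : nat) (la : intpart) : RP -> Prop :=
| USome ka of (forall i, collen ka i = (collen la i + (i == j))%N) : u_spec j la << ka >>
| UNone of ~~ ((j == 0%N) || (collen la j < collen la j.-1)%N) : u_spec j la 0.

Lemma uP j la : u_spec j la (u j << la >>).
Proof.
rewrite /u_op lin_extU; case e: (add_box j la) => [ka|] /=.
  by apply: USome; apply/add_boxP.
by apply: UNone; rewrite -add_box_ex e.
Qed.

Variant d_spec (j : nat) (la : intpart) : RP -> Prop :=
| DSome ka of (forall i, collen la i = (collen ka i + (i == j))%N) : d_spec j la << ka >>
| DNone of ~~ (collen la j.+1 < collen la j)%N : d_spec j la 0.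

Lemma dP j la : d_spec j la (d j << la >>).
Proof.
rewrite /d_op lin_extU; case e: (rem_box j la) => [ka|] /=.
  by apply: DSome; apply/rem_boxP.
by apply: DNone; rewrite -rem_box_ex e.
Qed.

Lemma full_opE j la :
  T j << la >> = if (0 < j)%N && (collen la j.-1 == collen la j) then << la >> else 0.
Proof. exact: lin_extU. Qed.

(** The two moves interact only for [j = i.+1], where either order requires columns [i] and [j] to
    differ in length by at least two. *)
Lemma du_comm i j v : i != j -> d i (u j v) = u j (d i v).
Proof.
move=> nij; move: v; apply: eq_lin; try by move=> c v w; rewrite !linearP.
move=> la; case: (uP j la) => [ka hka|h]; case: (dP i la) => [ka' hka'|h'].
- case: (dP i ka) => [l hl|hl]; case: (uP j ka') => [l' hl'|hl'] //.
  + apply: basis_eq => m.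
    by have := hka m; have := hka' m; have := hl m; have := hl' m; lia.
  + have := hka j; have := hka j.-1; have := hl j; have := hl j.-1; have := hka' j.
    have := hka' j.-1; have := collen_le l (leq_pred j); lia.
  + have := hka i; have := hka i.+1; have := hka' i; have := hka' i.+1; have := hl' i.
    have := hl' i.+1; have := collenS l' i; lia.
- rewrite !linear0; case: dP => [l hl|//].
  have := hka i; have := hka i.+1; have := hl i; have := hl i.+1; have := collenS l i.
  have := collenS la i.
  have := hka j; have := hka j.-1; have := hl j; have := hl j.-1; have := collen_le l (leq_pred j); lia.
- rewrite !linear0; case: uP => [l hl|//].
  have := hka' j; have := hka' j.-1; have := hl j; have := hl j.-1; have := collen_le l (leq_pred j).
  have := hka' i; have := hka' i.+1; have := hl i; have := hl i.+1; have := collenS l i.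
  have := collen_le la (leq_pred j); lia.
by rewrite !linear0.
Qed.

(** A box can be removed from column [j] exactly when columns [j] and [j.+1] differ, and it can then
    be put back. In [du_id] the obstruction to adding a box comes from the preceding column
    instead. *)
Lemma ud_id j v : u j (d j v) = v - T j.+1 v.
Proof.
move: v; apply: eq_lin => [c v w|c v w|la].
- by rewrite (linearP (d j)) (linearP (u j)).
- by rewrite (linearP (T j.+1)); mring.
rewrite full_opE /=; case: dP => [ka hka|h]; last first.
  by rewrite linear0; case: eqP; rewrite ?subrr // => ?; have := collenS la j; lia.
case: uP => [l hl|h]; last first.
  by have := hka j; have := hka j.-1; have := collen_le la (leq_pred j); lia.
have -> : l = la by apply: collen_inj => m; rewrite hl hka.
case: eqP => ?; last by rewrite subr0.
by have := hka j; have := hka j.+1; have := collenS ka j; lia.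
Qed.

Lemma du_id j v : d j (u j v) = v - T j v.
Proof.
move: v; apply: eq_lin => [c v w|c v w|la].
- by rewrite (linearP (u j)) (linearP (d j)).
- by rewrite (linearP (T j)); mring.
rewrite full_opE; case: uP => [ka hka|h]; last first.
  rewrite linear0; case: ifP => h'; rewrite ?subrr //.
  by have := collen_le la (leq_pred j); lia.
case: dP => [l hl|h]; last first.
  by have := hka j; have := hka j.+1; have := collenS la j; lia.
have -> : l = la by apply: collen_inj => m; have := hl m; rewrite hka; lia.
case: ifP => h'; last by rewrite subr0.
by have := hka j; have := hka j.-1; have := collen_le ka (leq_pred j); lia.
Qed.

Lemma dT_comm i j v : i != j -> i.+1 != j -> d i (T j v) = T j (d i v).
Proof.
move=> nij nij'; move: v; apply: eq_lin; try by move=> c v w; rewrite !linearP.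
move=> la; rewrite full_opE; case: dP => [ka hka|h].
  rewrite full_opE; have := hka j; have := hka j.-1 => h1 h2.
  have -> : (0 < j)%N && (collen ka j.-1 == collen ka j) = (0 < j)%N && (collen la j.-1 == collen la j).
    by lia.
  case: ifP => h; last by rewrite linear0.
  case: dP => [l hl|hl]; last by have := hka i; have := hka i.+1; have := collenS ka i; lia.
  by apply: basis_eq => m; have := hka m; rewrite hl; lia.
rewrite !linear0; case: ifP => ?; last by rewrite linear0.
case: dP => // l hl; have := hl i; have := hl i.+1; have := collenS l i; lia.
Qed.

Lemma Td0 j v : T j (d j v) = 0.
Proof.
move: v; apply: eq_lin; try by move=> c v w; rewrite ?linearP ?scaler0 ?addr0.
move=> la; case: dP => [ka hka|h]; last by rewrite linear0.
rewrite full_opE; case: ifP => // ?.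
by have := hka j; have := hka j.-1; have := collen_le la (leq_pred j); lia.
Qed.

Lemma uT0 j v : u j (T j v) = 0.
Proof.
move: v; apply: eq_lin; try by move=> c v w; rewrite ?linearP ?scaler0 ?addr0.
move=> la; rewrite full_opE; case: ifP => ?; last by rewrite linear0.
case: uP => // ka hka.
by have := hka j; have := hka j.-1; have := collen_le ka (leq_pred j); lia.
Qed.

Lemma Tu0 j v : T j.+1 (u j v) = 0.
Proof.
move: v; apply: eq_lin; try by move=> c v w; rewrite ?linearP ?scaler0 ?addr0.
move=> la; case: uP => [ka hka|h]; last by rewrite linear0.
rewrite full_opE /=; case: ifP => // ?.
by have := hka j; have := hka j.+1; have := collenS la j; lia.
Qed.

Lemma dT0 j v : d j (T j.+1 v) = 0.
Proof.
move: v; apply: eq_lin; try by move=> c v w; rewrite ?linearP ?scaler0 ?addr0.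
move=> la; rewrite full_opE /=; case: ifP => ?; last by rewrite linear0.
case: dP => // ka hka.
by have := hka j; have := hka j.+1; have := collenS ka j; lia.
Qed.

Lemma iter_d_zero j k : iter k (d j) 0 = 0.
Proof. by elim: k => //= k ->; rewrite linear0. Qed.

Lemma iter_d0 j k la : (collen la j < k)%N -> iter k (d j) << la >> = 0.
Proof.
elim: k la => // k IH la hk; rewrite iterSr; case: dP => [ka hka|_].
  by apply: IH; have := hka j; rewrite eqxx; lia.
exact: iter_d_zero.
Qed.

Lemma dtE j la M : (collen la j <= M)%N ->
  D j << la >> = \sum_(0 <= k < M) beta ^+ k *: iter k.+1 (d j) << la >>.
Proof.
move=> hM; rewrite /dt_op lin_extU big_add1 /= [RHS](big_cat_nat (n := collen la j)) //=.
rewrite [X in _ + X]big_nat_cond [X in _ + X]big1 ?addr0 // => k hk.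
by rewrite -iterS iter_d0 ?scaler0 //; lia.
Qed.

(** This is [D = d (1 - beta d)^-1] with the denominator cleared; the relations for [D] below are
    derived from it. *)
Lemma dt_rec j v : D j v = d j v + beta *: D j (d j v).
Proof.
move: v; apply: eq_lin => [c v w|c v w|la]; first by rewrite (linearP (D j)).
  by rewrite (linearP (d j)) (linearP (D j)); mring.
rewrite (@dtE j la (collen la j).+1) // big_nat_recl // expr0 scale1r /=; congr (_ + _).
under eq_bigr do rewrite exprS -scalerA.
rewrite -scaler_sumr; congr (_ *: _).
have := dP j la; move e: (d j << la >>) => w hw; case: hw e => [ka hka|_] e.
  rewrite (@dtE j ka (collen la j)); last by have := hka j; lia.
  by apply: eq_bigr => k _; rewrite -e -!iterS -iterSr.
rewrite linear0 big1 // => k _; rewrite -!iterS 2!iterSr e.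
by rewrite linear0 iter_d_zero scaler0.
Qed.

(** [dt_rec] expresses [D j] on a partition through [D j] on one with a shorter column [j], whence
    an induction on the length of that column. *)
Lemma dt_comm j (X : {linear RP -> RP}) :
  (forall v, d j (X v) = X (d j v)) -> forall v, D j (X v) = X (D j v).
Proof.
move=> hX; apply: eq_lin; try by move=> c v w; rewrite !linearP.
move=> la; move: {2}(collen la j) (leqnn (collen la j)) => m; elim: m la => [|m IH] la hm.
  rewrite dt_rec [in RHS]dt_rec hX; case: dP => [ka /(_ j)|_]; first by lia.
  by rewrite ?(linear0, scaler0, addr0).
rewrite dt_rec [in RHS]dt_rec hX; case: dP => [ka hka|_]; last first.
  by rewrite ?(linear0, scaler0, addr0).
by rewrite IH ?linearD ?linearZ //; have := hka j; lia.
Qed.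

Lemma dt_recr j v : D j v = d j v + beta *: d j (D j v).
Proof. by rewrite {1}dt_rec (@dt_comm j (d j)). Qed.

Lemma TD0 j v : T j (D j v) = 0.
Proof. by rewrite dt_recr (linearD (T j)) (linearZZ (T j)) /= !Td0 scaler0 addr0. Qed.

Lemma DT0 j v : D j (T j.+1 v) = 0.
Proof. by rewrite dt_rec dT0 linear0 scaler0 addr0. Qed.

Lemma utE j v : U j v = u j v - beta *: (v - T j.+1 v).
Proof. by rewrite /ut_op (linearB (u j)) (linearZZ (u j)) /= ud_id. Qed.

Lemma UD j v : U j (D j v) = v - T j.+1 v.
Proof. by rewrite /ut_op {1}dt_recr addrK ud_id. Qed.

(** Since [T d = 0], one has [d U = (1 - T) (1 - beta d) = (1 - beta d) - T]. Applying
    [(1 - beta d)^-1 = 1 + beta D] gives the claim. *)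
Lemma DU j v : D j (U j v) = v - (T j v + beta *: D j (T j v)).
Proof.
have hd : d j (U j v) = v - beta *: d j v - T j v.
  by rewrite /ut_op du_id (linearB (T j)) (linearZZ (T j)) /= Td0 scaler0 subr0.
rewrite dt_rec hd !(linearB (D j)) (linearZZ (D j)) /= [in D j v]dt_rec.
mring.
Qed.

(** The argument is [(1 - beta d)^-1 T v]; the factor [1 - beta d] of [U] cancels the denominator
    and leaves [u T = 0]. *)
Lemma UDT0 j v : U j (T j v + beta *: D j (T j v)) = 0.
Proof.
rewrite /ut_op (linearD (d j)) (linearZZ (d j)) /= {1}(dt_recr j (T j v)).
rewrite -[RHS](uT0 j v); congr (u j _); mring.
Qed.

Lemma TU0 j v : T j.+1 (U j v) = 0.
Proof. exact: Tu0. Qed.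

Lemma DU_comm i j v : i != j -> i != j.+1 -> D i (U j v) = U j (D i v).
Proof.
move=> nij nij'; move: v; apply: (@dt_comm i (U j)) => v.
rewrite /= (utE j v) (utE j (d i v)) (linearB (d i)) (linearZZ (d i)) (linearB (d i)) /=.
by rewrite (du_comm v nij) (@dT_comm i j.+1 v nij' nij).
Qed.

(** In [U j = u j - beta (1 - T j.+1)] only the last term fails to commute with [D j.+1], and one of
    the two orders vanishes because [T D = 0]. *)
Lemma DU_succ j v : D j.+1 (U j v) = U j (D j.+1 v) + beta *: D j.+1 (T j.+1 v).
Proof.
rewrite (utE j v) (utE j (D j.+1 v)) (linearB (D j.+1)) (linearZZ (D j.+1)) (linearB (D j.+1)) /= TD0.
rewrite (@dt_comm j.+1 (u j)); last first.
  by move=> w; apply: du_comm; lia.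
mring.
Qed.

End Ops.

(** * Commutation of A and B, and their inverses *)

HB.lock Definition a_op (R : comNzRingType) (beta x : R) (j : nat) (v : {malg R[intpart]}) :
  {malg R[intpart]} := v + x *: ut_op beta j v.
HB.lock Definition b_op (R : comNzRingType) (beta y : R) (j : nat) (v : {malg R[intpart]}) :
  {malg R[intpart]} := v + y *: dt_op beta j v.
(** This is [(1 - beta d)^-1 T], the defect in [D U = 1 - E] for one column. *)
HB.lock Definition E_op (R : comNzRingType) (beta : R) (j : nat) (v : {malg R[intpart]}) :
  {malg R[intpart]} := full_op j v + beta *: dt_op beta j (full_op j v).

Section Commutation.

Variables (R : comNzRingType) (beta : R).
Local Notation RP := {malg R[intpart]}.
Local Notation U := (ut_op beta).
Local Notation D := (dt_op beta).
Local Notation T := (@full_op R).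

Local Notation a_op := (a_op beta).
Local Notation b_op := (b_op beta).

Lemma a_op_is_linear x j : linear (a_op x j).
Proof. by move=> c v w; rewrite a_op.unlock (linearP (U j)); mring. Qed.
Lemma b_op_is_linear x j : linear (b_op x j).
Proof. by move=> c v w; rewrite b_op.unlock (linearP (D j)); mring. Qed.
HB.instance Definition _ x (j : nat) :=
  GRing.isLinear.Build R RP RP *:%R (a_op x j) (a_op_is_linear x j).
HB.instance Definition _ x (j : nat) :=
  GRing.isLinear.Build R RP RP *:%R (b_op x j) (b_op_is_linear x j).

Definition A_cols (x : R) (s : seq nat) (v : RP) : RP := foldl (fun w j => a_op x j w) v s.
Definition B_cols (y : R) (s : seq nat) (v : RP) : RP := foldr (b_op y) v s.

Lemma A_cols_is_linear x s : linear (A_cols x s).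
Proof. elim: s => // j s IH c v w.
rewrite -[LHS]/(A_cols x s (a_op x j (c *: v + w))) (linearP (a_op x j)); exact: IH. Qed.
Lemma B_cols_is_linear y s : linear (B_cols y s).
Proof. elim: s => // j s IH c v w.
rewrite -[LHS]/(b_op y j (B_cols y s (c *: v + w))) IH; exact: (linearP (b_op y j)). Qed.
HB.instance Definition _ x s :=
  GRing.isLinear.Build R RP RP *:%R (A_cols x s) (A_cols_is_linear x s).
HB.instance Definition _ x s :=
  GRing.isLinear.Build R RP RP *:%R (B_cols x s) (B_cols_is_linear x s).

Variables x y : R.
Local Notation a := (a_op x).
Local Notation b := (b_op y).

Local Notation E := (E_op beta).

Lemma ba_comm j v : b j (a j v) = a j (b j v) - (x * y) *: (E j v - T j.+1 v).
Proof.
rewrite b_op.unlock a_op.unlock (linearD (D j)) (linearZZ (D j)) (linearD (U j)) (linearZZ (U j)) /=.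
by rewrite UD DU E_op.unlock; mring.
Qed.

Lemma ba_far i j v : i != j -> i != j.+1 -> b i (a j v) = a j (b i v).
Proof.
move=> h h'.
rewrite b_op.unlock a_op.unlock (linearD (D i)) (linearZZ (D i)) (linearD (U j)) (linearZZ (U j)) /=.
have := DU_comm beta v h h'.
by generalize (D i (U j v)) (U j (D i v)) => p q ->; mring.
Qed.

Lemma ba_succ j v :
  b j.+1 (a j v) = a j (b j.+1 v) + (x * y * beta) *: D j.+1 (T j.+1 v).
Proof.
rewrite b_op.unlock a_op.unlock (linearD (D j.+1)) (linearZZ (D j.+1)) (linearD (U j)) (linearZZ (U j)) /=.
have := DU_succ beta j v.
by generalize (D j.+1 (U j v)) (U j (D j.+1 v)) => p q ->; mring.
Qed.

Lemma Ta j v : T j.+1 (a j v) = T j.+1 v.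
Proof. by rewrite a_op.unlock (linearD (T j.+1)) (linearZZ (T j.+1)) /= TU0 scaler0 addr0. Qed.

Lemma Tb j v : T j (b j v) = T j v.
Proof. by rewrite b_op.unlock (linearD (T j)) (linearZZ (T j)) /= TD0 scaler0 addr0. Qed.

Lemma bT j v : b j (T j.+1 v) = T j.+1 v.
Proof. by rewrite b_op.unlock DT0 scaler0 addr0. Qed.

Lemma aE j v : a j (E j v) = E j v.
Proof. by rewrite a_op.unlock E_op.unlock UDT0 scaler0 addr0. Qed.

(** It is used with [A = a i.+1], [B = b i], [p = T i.+1 w] and [e = E i.+1 w]. The corrections [p]
    and [c *: q] add up to [e], which cancels because [A] fixes [B e]. *)
Lemma A_cols_B_cols_cancel (A B : {linear RP -> RP}) (z c : R) X Y F p q e :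
  B X = Y - z *: (F - p) -> B p = p -> B e = A (B e) -> e = p + c *: q ->
  A (B (X + (z * c) *: q)) - z *: B e = A Y - z *: A F.
Proof.
move=> hX hp he eE; rewrite he eE !(linearD B) !(linearZZ B) /= hX hp.
rewrite !(linearD A) (linearN A) !(linearZZ A) (linearB A) /=.
by move: (A (B q)) (A Y) (A F) (A p) => q1 q2 q3 q4; mring.
Qed.

(** Exchanging the factors of columns [i] and [i.+1] moves the defect [E] from column [i.+1] to
    column [i]. *)
Lemma A_cols_B_cols_local i w :
  b i (a i.+1 (b i.+1 (a i w))) - (x * y) *: b i (E i.+1 (a i w))
  = a i.+1 (a i (b i (b i.+1 w))) - (x * y) *: a i.+1 (E i (b i.+1 w)).
Proof.
have -> : E i.+1 (a i w) = E i.+1 w by rewrite E_op.unlock Ta.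
rewrite (@ba_far i i.+1); [|lia|lia].
rewrite (ba_succ i w); apply: (@A_cols_B_cols_cancel (a i.+1) (b i) _ _ _ _ _ (T i.+1 w)).
- by rewrite /= ba_comm Tb.
- exact: bT.
- by rewrite /= -{1}aE ba_far //; lia.
- by rewrite E_op.unlock.
Qed.

Lemma b_A_cols_far i j n v : (i < j)%N -> b i (A_cols x (iota j n) v) = A_cols x (iota j n) (b i v).
Proof. by elim: n j v => //= n IH j v hij; rewrite IH ?ba_far //; lia. Qed.

Lemma B_cols_a_far i j n v : (i.+1 < j)%N -> B_cols y (iota j n) (a i v) = a i (B_cols y (iota j n) v).
Proof. by elim: n j v => //= n IH j v hij; rewrite IH ?ba_far //; lia. Qed.

(* At i = 0 the last term vanishes, because T_0 = 0. *)
Lemma A_cols_B_cols_iota n i v :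
  let M := (i + n.+1)%N in
  let w := A_cols x (iota i n.+1) v in
  B_cols y (iota i n.+1) (w - (x * y) *: T M w)
  = A_cols x (iota i n.+1) (B_cols y (iota i n.+1) v)
    - (x * y) *: A_cols x (iota i.+1 n) (E i (B_cols y (iota i.+1 n) v)).
Proof.
elim: n i v => [|n IH] i v /=.
  rewrite addn1 Ta (linearB (b i)) (linearZZ (b i)) /= ba_comm bT.
  by move: (a i (b i v)) (E i v) => p q; mring.
(* The factors of column [i] pass those of the columns from [i.+2] on, so that only the local
   identity for columns [i] and [i.+1] remains. *)
have /= := IH i.+1 (a i v); rewrite addSnnS => ->.
rewrite (linearB (b i)) (linearZZ (b i)) /= !b_A_cols_far; [|lia|lia].
rewrite !B_cols_a_far; [|lia].
set s := iota _ n; set w := B_cols y s v.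
rewrite -(linearZZ (A_cols x s)) -(linearB (A_cols x s)) /= A_cols_B_cols_local.
by rewrite (linearB (A_cols x s)) (linearZZ (A_cols x s)).
Qed.

(** On partitions with fewer than [N] columns [T N] is the identity, and the correction becomes the
    factor [1 - x * y]. *)
Lemma A_cols_B_cols N v :
  A_cols x (iota 0 N) (B_cols y (iota 0 N) v)
  = B_cols y (iota 0 N) (A_cols x (iota 0 N) v - (x * y) *: T N (A_cols x (iota 0 N) v)).
Proof.
have T0 w : T 0 w = 0.
  move: w; apply: eq_lin => [c v' w|c v' w|la]; last by rewrite full_opE.
    by rewrite (linearP (T 0)).
  by rewrite scaler0 addr0.
case: N => [|n]; first by rewrite /= T0 scaler0 subr0.
have /= -> := A_cols_B_cols_iota n 0 v.
by rewrite E_op.unlock T0 (linear0 (D 0)) scaler0 addr0 (linear0 (A_cols x (iota 1 n))) scaler0 subr0.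
Qed.

End Commutation.

Lemma A_opE (R : comNzRingType) (beta : R) N x v : A_op beta N x v = A_cols beta x (iota 0 N) v.
Proof. by rewrite /A_op /A_cols a_op.unlock. Qed.

(** * Inverses of the column factors *)

Section Inverse.
Variables (R : comNzRingType) (beta t : R).
Local Notation RP := {malg R[intpart]}.

(** Substitute [d v = Db v - beta *: d (Db v)] in the recursion for [Dt]: the two recursions are
    needed with [d] on opposite sides. *)
Lemma resolvent (d Dt Db : {linear RP -> RP}) v :
  Db v = d v + beta *: d (Db v) -> (forall w, Dt w = d w + t *: Dt (d w)) ->
  v + (beta - t) *: Db v + (- (beta - t)) *: Dt (v + (beta - t) *: Db v) = v.
Proof.
move=> hb ht; rewrite (linearD Dt) (linearZZ Dt) /=.
have hd : d v = Db v - beta *: d (Db v) by rewrite {1}hb addrK.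
have := ht v; rewrite hd (linearB Dt) (linearZZ Dt) /= => ->.
have := ht (Db v); move: (Dt (Db v)) => p -> {hb hd}.
by move: (Db v) => z; move: (Dt (d z)) => ?; move: (d z) => ?; mring.
Qed.

(* The resolvent identity for d_j / (1 - beta d_j) and d_j / (1 - t d_j). *)
Lemma b_opK j v : b_op t (- (beta - t)) j (b_op beta (beta - t) j v) = v.
Proof.
rewrite !b_op.unlock; apply: (@resolvent (d_op j) (dt_op t j) (dt_op beta j)).
  exact: dt_recr.
exact: dt_rec.
Qed.

Definition Binv_cols (y : R) (s : seq nat) (v : RP) : RP :=
  foldl (fun w j => b_op t (- y) j w) v s.

Lemma B_colsK s v : Binv_cols (beta - t) s (B_cols beta (beta - t) s v) = v.
Proof. by elim: s v => // j s IH v; rewrite -[RHS]IH {2}/Binv_cols /= b_opK. Qed.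

Lemma Binv_cols_is_linear y s : linear (Binv_cols y s).
Proof.
elim: s => // j s IH c v w.
rewrite -[LHS]/(Binv_cols y s (b_op t (- y) j (c *: v + w))) (linearP (b_op t (- y) j)); exact: IH.
Qed.
HB.instance Definition _ y s :=
  GRing.isLinear.Build R RP RP *:%R (Binv_cols y s) (Binv_cols_is_linear y s).
End Inverse.

(* With q = 1 / (1 - beta x), one has
   1 + x U_j = (1 - beta x (1 - T_(j+1))) (1 + q x u_j):
   [ainv_diag] inverts the first factor, and a geometric sum, finite because x is
   nilpotent, inverts the second one. *)
HB.lock Definition ainv_diag (R : comNzRingType) (q : R) (j : nat) (v : {malg R[intpart]}) :
    {malg R[intpart]} := v - (1 - q) *: (v - full_op j.+1 v).
HB.lock Definition ainv_op (R : comNzRingType) (K : nat) (q x : R) (j : nat) (v : {malg R[intpart]}) :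
    {malg R[intpart]} :=
  \sum_(0 <= k < K.+1) (- (q * x)) ^+ k *:
     iter k (u_op j) (ainv_diag q j v).

Section InverseA.
Variables (R : comNzRingType) (beta q x : R) (K : nat).
Hypotheses (qP : q * (1 - beta * x) = 1) (xP : x ^+ K.+1 = 0).
Local Notation RP := {malg R[intpart]}.
Local Notation ai := (ainv_op K q x).

Lemma iter_u_is_linear j k : linear (iter k (@u_op R j)).
Proof. by elim: k => // k IH c v w; rewrite !iterS IH; apply: (linearP (u_op j)). Qed.

Lemma ainv_diag_is_linear j : linear (@ainv_diag R q j).
Proof. by move=> c v w; rewrite ainv_diag.unlock (linearP (full_op j.+1)); mring. Qed.

Lemma ainv_op_is_linear j : linear (ai j).
Proof.
move=> c v w; rewrite ainv_op.unlock ainv_diag_is_linear scaler_sumr -big_split /=.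
apply: eq_bigr => k _; rewrite (iter_u_is_linear j k c).
by move: (_ ^+ k) (iter k _ _) (iter k _ _) => ? ? ?; mring.
Qed.
HB.instance Definition _ j :=
  GRing.isLinear.Build R RP RP *:%R (ai j) (ainv_op_is_linear j).

Lemma a_opK j v : ai j (a_op beta x j v) = v.
Proof.
rewrite ainv_op.unlock.
have -> : ainv_diag q j (a_op beta x j v) = v + (q * x) *: u_op j v.
  rewrite ainv_diag.unlock Ta a_op.unlock utE.
  apply/eqP; rewrite -subr_eq0; apply/eqP.
  have -> : v + x *: (u_op j v - beta *: (v - full_op j.+1 v)) -
     (1 - q) *: (v + x *: (u_op j v - beta *: (v - full_op j.+1 v)) - full_op j.+1 v) -
     (v + (q * x) *: u_op j v) = (q * (1 - beta * x) - 1) *: (v - full_op j.+1 v).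
    by mring.
  by rewrite qP subrr scale0r.
rewrite big_nat; under eq_bigr => k _.
  rewrite [v + _]addrC (iter_u_is_linear j k (q * x) (u_op j v) v) scalerDr scalerA.
  over.
rewrite -big_nat big_split /= addrC.
(* The two sums cancel after a shift of the index: the term [k = 0] leaves [v], and the top term
   contains [x ^+ K.+1]. *)
rewrite big_nat_recl // expr0 scale1r /= -[RHS]addr0 -addrA; congr (_ + _).
rewrite [X in _ + X]big_nat_recr //=.
have -> : (- (q * x)) ^+ K * (q * x) = 0.
  by rewrite exprNn exprMn -!mulrA [x ^+ K * _]mulrCA -exprSr xP !mulr0.
rewrite scale0r addr0 -big_split big1 //= => k _.
have -> : iter k (u_op j) (u_op j v) = u_op j (iter k (u_op j) v) by rewrite -iterS iterSr.
by rewrite -scalerDl exprS mulNr mulrC addNr scale0r.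
Qed.

End InverseA.

(** * Matrix entries of A, B and their inverses *)

Section Entries.
Variables (R : comNzRingType).
Local Notation RP := {malg R[intpart]}.

Definition off_col (j : nat) (la ka : intpart) : Prop :=
  forall i, i != j -> collen ka i = collen la i.

Lemma mcoeff_linear (f : {linear RP -> RP}) v (ka : intpart) (D : {fset intpart}) :
  (forall la, la \notin D -> mcoeff la v * mcoeff ka (f << la >>) = 0) ->
  mcoeff ka (f v) = \sum_(la <- D) mcoeff la v * mcoeff ka (f << la >>).
Proof.
move=> hD.
have -> : mcoeff ka (f v) = \sum_(la <- msupp v) mcoeff la v * mcoeff ka (f << la >>).
  rewrite {1}[v]malg_basis linear_sum raddf_sum /=; apply: eq_bigr => la _.
  by rewrite (linearZZ f) mcoeffZ.
rewrite (big_fset_incl _ (fsubsetUl (msupp v) D)) /=; last first.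
  by move=> la _ /mcoeff_outdom ->; rewrite mul0r.
by rewrite [RHS](big_fset_incl _ (fsubsetUr (msupp v) D)) //= => la _; apply: hD.
Qed.

Lemma mcoeff_linear1 (f : {linear RP -> RP}) v (ka rho : intpart) :
  (forall la, la != rho -> mcoeff la v * mcoeff ka (f << la >>) = 0) ->
  mcoeff ka (f v) = mcoeff rho v * mcoeff ka (f << rho >>).
Proof.
move=> h; rewrite (@mcoeff_linear f v ka [fset rho]%fset) ?big_seq_fset1 //.
by move=> la; rewrite in_fset1; apply: h.
Qed.

Lemma mcoeff_linear0 (f : {linear RP -> RP}) v (ka : intpart) :
  (forall la, mcoeff la v * mcoeff ka (f << la >>) = 0) -> mcoeff ka (f v) = 0.
Proof. by move=> h; rewrite (@mcoeff_linear f v ka fset0) ?big_seq_fset0. Qed.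

(* [phi old next new] is the weight of changing the length of a column from old
   to new when the next column has length next. That the result is a partition
   is automatic, since ka is one. *)
Variables (f : nat -> {linear RP -> RP}) (phi : nat -> nat -> nat -> R).
Hypothesis f_entries : forall j la ka, mcoeff ka (f j << la >>)
  = if `[< off_col j la ka >] then phi (collen la j) (collen la j.+1) (collen ka j) else 0.

Let asc s v := foldl (fun w j => f j w) v s.
Let desc s v := foldr (fun j w => f j w) v s.

Lemma asc_is_linear s : linear (asc s).
Proof.
elim: s => // j s IH c v w.
rewrite -[LHS]/(asc s (f j (c *: v + w))) (linearP (f j)); exact: IH.
Qed.

Definition out_cols (i n : nat) (la ka : intpart) : Prop :=
  forall j, ~~ (i <= j < i + n)%N -> collen ka j = collen la j.

Lemma set_col (la : intpart) i m :
  (collen la i.+1 <= m)%N -> ((i == 0%N) || (m <= collen la i.-1)%N) ->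
  exists2 rho, off_col i la rho & collen rho i = m.
Proof.
move=> h1 h2.
have [||rho h] := @part_of_cols (fun j => if j == i then m else collen la j)
    (maxn i.+1 (head 0%N la)).
- move=> j; case: (eqVneq j.+1 i) => [e|n1]; case: (eqVneq j i) => [e'|n2]; try lia.
  + by move: h2; rewrite -e /=; lia.
  + by rewrite e'.
  + exact: collenS.
- by move=> j hj; case: eqP => [|_]; [lia | apply: collen0; lia].
by exists rho => [j /negPf nj|]; rewrite h ?eqxx ?nj.
Qed.

(** The intermediate partitions are forced: treated columns are those of [ka], the others those of
    [la]. In increasing order column [j.+1] is still that of [la] when column [j] changes, which
    gives the inequality and the middle argument of [phi]. *)
Lemma asc_entries i n la ka :
  mcoeff ka (asc (iota i n) << la >>)
  = if `[< out_cols i n la ka /\ forall j, (i <= j < i + n)%N -> (collen la j.+1 <= collen ka j)%N >]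
    then \prod_(j <- iota i n) phi (collen la j) (collen la j.+1) (collen ka j) else 0.
Proof.
elim: n i la => [|n IH] i la.
  rewrite /= big_nil mcoeffU; case: asboolP => [[h _]|h].
    by rewrite (@collen_inj la ka) ?eqxx // => j; rewrite h //; lia.
  case: eqP => // e; case: h; split=> j; first by rewrite e.
  by lia.
rewrite -[asc _ _]/(asc (iota i.+1 n) (f i << la >>)) big_cons.
pose g : {linear RP -> RP} := HB.pack (asc (iota i.+1 n))
   (GRing.isLinear.Build R RP RP *:%R _ (asc_is_linear (iota i.+1 n))).
rewrite -[asc (iota i.+1 n)]/(g : RP -> RP).
case: asboolP => [[hout hj]|hn].
  have [|| rho off_rho rho_i] := @set_col la i (collen ka i).
  - by apply: hj; lia.
  - case: (eqVneq i 0%N) => //= i0; rewrite -(hout i.-1); last by lia.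
    by apply: collen_le; lia.
  rewrite (@mcoeff_linear1 g _ ka rho).
    rewrite f_entries /= IH !asboolT //; last first.
      split=> j; first by move=> h; case: (eqVneq j i) => [->|nj]; rewrite ?rho_i // off_rho // hout //; lia.
      by move=> h; rewrite off_rho; [apply: hj | ]; lia.
    rewrite rho_i; congr (_ * _); apply: eq_big_seq => j; rewrite mem_iota => hjj.
    by rewrite !off_rho //; lia.
  move=> ro nro; rewrite f_entries /= IH.
  case: asboolP => h1; rewrite ?mul0r //; case: asboolP => [[h2 h3]|]; rewrite ?mulr0 //.
  case/eqP: nro; apply: collen_inj => j; case: (eqVneq j i) => [->|nj].
    by rewrite rho_i h2 //; lia.
  by rewrite off_rho // h1.
apply: mcoeff_linear0 => ro; rewrite f_entries /= IH.
case: asboolP => h1; rewrite ?mul0r //; case: asboolP => [[h2 h3]|]; rewrite ?mulr0 //.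
case: hn; split=> j hj; first by rewrite h2 ?h1 //; lia.
case: (eqVneq j i) => [->|nj]; last by rewrite -h1 ?h3 //; lia.
by rewrite h2 -?h1 ?collenS //; lia.
Qed.

(** In decreasing order column [j.+1] already has its final length when column [j] changes. *)
Lemma desc_entries i n la ka :
  mcoeff ka (desc (iota i n) << la >>)
  = if `[< out_cols i n la ka /\ forall j, (i <= j < i + n)%N -> (collen ka j.+1 <= collen la j)%N >]
    then \prod_(j <- iota i n) phi (collen la j) (collen ka j.+1) (collen ka j) else 0.
Proof.
elim: n i ka => [|n IH] i ka.
  rewrite /= big_nil mcoeffU; case: asboolP => [[h _]|h].
    by rewrite (@collen_inj la ka) ?eqxx // => j; rewrite h //; lia.
  case: eqP => // e; case: h; split=> j; first by rewrite e.
  by lia.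
rewrite -[desc _ _]/(f i (desc (iota i.+1 n) << la >>)) big_cons.
case: asboolP => [[hout hj]|hn].
  have [|| rho off_rho rho_i] := @set_col ka i (collen la i).
  - by apply: hj; lia.
  - case: (eqVneq i 0%N) => //= i0; rewrite (hout i.-1); last by lia.
    by apply: collen_le; lia.
  rewrite (@mcoeff_linear1 (f i) _ ka rho).
    rewrite f_entries IH !asboolT //; last first.
    - split=> j; first by move=> h; case: (eqVneq j i) => [->|nj]; rewrite ?rho_i // off_rho // hout //; lia.
      by move=> h; rewrite off_rho; [apply: hj | ]; lia.
    - by move=> j nj; rewrite off_rho.
    rewrite mulrC rho_i off_rho; last by lia.
    congr (_ * _); apply: eq_big_seq => j; rewrite mem_iota => hjj.
    by rewrite !off_rho //; lia.
  move=> ro nro; rewrite f_entries IH.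
  case: asboolP => [[h2 h3]|]; rewrite ?mul0r //; case: asboolP => h1; rewrite ?mulr0 //.
  case/eqP: nro; apply: collen_inj => j; case: (eqVneq j i) => [->|nj].
    by rewrite rho_i h2 //; lia.
  by rewrite off_rho // -h1.
apply: mcoeff_linear0 => ro; rewrite f_entries IH.
case: asboolP => [[h2 h3]|]; rewrite ?mul0r //; case: asboolP => h1; rewrite ?mulr0 //.
case: hn; split=> j hj; first by rewrite h1 ?h2 //; lia.
case: (eqVneq j i) => [->|nj]; last by rewrite h1 ?h3 //; lia.
by rewrite h1 -?[collen la i]h2 ?collenS //; lia.
Qed.

End Entries.

Section LocalEntries.
Variables (R : comNzRingType) (beta x : R).
Local Notation RP := {malg R[intpart]}.

Lemma mcoeff_basis (la ka : intpart) : mcoeff ka (<< la >> : RP) = (la == ka)%:R.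
Proof. by rewrite mcoeffU. Qed.

Lemma iter_u_entries j k la ka : mcoeff ka (iter k (@u_op R j) << la >>)
  = (`[< off_col j la ka >] && (collen ka j == collen la j + k)%N)%:R.
Proof.
elim: k la => [|k IH] la.
  rewrite /= mcoeff_basis; congr (nat_of_bool _)%:R; apply/eqP/andP => [->|[/asboolP h /eqP e]].
    by rewrite addn0 eqxx; split=> //; apply/asboolP.
  by apply: collen_inj => i; case: (eqVneq i j) => [->|ni]; rewrite ?e ?addn0 // h.
rewrite iterSr; case: uP => [l hl|hn].
  rewrite IH; congr (nat_of_bool _)%:R; congr (_ && _); last by rewrite hl; lia.
  by apply: asbool_equiv_eq; split=> h i ni; rewrite h // hl (negPf ni) addn0.
rewrite (_ : iter k (u_op j) 0 = 0); last by elim: (k) => //= m ->; rewrite (linear0 (u_op j)).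
rewrite mcoeff0; case: asboolP => //= h; case: eqP => // e.
by have := h j.-1; have := collen_le ka (leq_pred j); lia.
Qed.

Lemma iter_d_entries j k la ka : mcoeff ka (iter k (@d_op R j) << la >>)
  = (`[< off_col j la ka >] && (collen la j == collen ka j + k)%N)%:R.
Proof.
elim: k la => [|k IH] la.
  rewrite /= mcoeff_basis; congr (nat_of_bool _)%:R; apply/eqP/andP => [->|[/asboolP h /eqP e]].
    by rewrite addn0 eqxx; split=> //; apply/asboolP.
  by apply: collen_inj => i; case: (eqVneq i j) => [->|ni]; rewrite ?e ?addn0 // h.
rewrite iterSr; case: dP => [l hl|hn].
  rewrite IH; congr (nat_of_bool _)%:R; congr (_ && _); last by rewrite hl; lia.
  by apply: asbool_equiv_eq; split=> h i ni; rewrite h // hl (negPf ni) addn0.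
rewrite iter_d_zero mcoeff0; case: asboolP => //= h; case: eqP => // e.
by have := h j.+1; have := collenS ka j; lia.
Qed.

Lemma off_col_eq j la ka : off_col j la ka -> (la == ka) = (collen ka j == collen la j).
Proof.
move=> h; apply/eqP/eqP => [->//|e]; apply: collen_inj => i.
by case: (eqVneq i j) => [->|ni]; rewrite ?e ?h.
Qed.

(** The diagonal value comes from [1 - beta x (1 - T j.+1)]: the test [next < old] says that the
    column has a removable box. *)
Definition a_wt (old next new : nat) : R :=
  if new == old.+1 then x else if new == old then 1 - beta * x * (next < old)%:R else 0.

Lemma a_entries j la ka : mcoeff ka (a_op beta x j << la >>)
  = if `[< off_col j la ka >] then a_wt (collen la j) (collen la j.+1) (collen ka j) else 0.
Proof.
rewrite a_op.unlock utE mcoeffD mcoeffZ mcoeffB mcoeffZ mcoeffB mcoeff_basis full_opE /=.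
have -> : mcoeff ka (u_op j << la >>) = mcoeff ka (iter 1 (@u_op R j) << la >>) by [].
rewrite iter_u_entries addn1 (fun_if (mcoeff ka)) mcoeff_basis mcoeff0 /a_wt.
case: asboolP => [h|h] /=; last first.
  case: (eqVneq la ka) h => [-> h|_ _]; first by case: h.
  by case: ifP => _; rewrite /=; ring.
rewrite (off_col_eq h); have := collenS la j.
case: (eqVneq (collen ka j) (collen la j)) => [e|ne] h'.
  rewrite e (ltn_eqF (ltnSn _)) /=; case: ltnP => h''.
    by rewrite ifF; [rewrite /=; ring | lia].
  by rewrite ifT; [rewrite /=; ring | lia].
by case: ifP => _; case: ifP => _; rewrite /=; ring.
Qed.

End LocalEntries.

Section LocalEntriesB.
Variables (R : comNzRingType) (beta y : R).
Local Notation RP := {malg R[intpart]}.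

Definition b_wt (old new : nat) : R :=
  if (new < old)%N then y * beta ^+ (old - new).-1 else (new == old)%:R.

Lemma b_entries j la ka : mcoeff ka (b_op beta y j << la >>)
  = if `[< off_col j la ka >] then b_wt (collen la j) (collen ka j) else 0.
Proof.
rewrite b_op.unlock mcoeffD mcoeffZ mcoeff_basis (dtE beta (leqnn (collen la j))).
rewrite raddf_sum /=.
under eq_bigr => k _ do rewrite mcoeffZ -iterS iter_d_entries.
case: asboolP => [h|h]; last first.
  rewrite big1 => [|k _]; last by rewrite mulr0.
  by case: (eqVneq la ka) h => [-> h|_ _]; [case: h | rewrite mulr0 addr0].
rewrite (off_col_eq h) /b_wt; case: ltnP => h'.
  rewrite ltn_eqF // add0r; congr (_ * _).
  rewrite (bigD1_seq (collen la j - collen ka j).-1) ?iota_uniq //=; last first.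
    by rewrite mem_index_iota; lia.
  rewrite (_ : collen la j == _) ?mulr1; last by lia.
  rewrite big1 ?addr0 // => k hk; rewrite (_ : (collen la j == _) = false) ?mulr0 //.
  by lia.
rewrite big1 ?mulr0 ?addr0 // => k _; rewrite (_ : (collen la j == _) = false) ?mulr0 //.
by lia.
Qed.

Lemma prod_b_wt (s : seq nat) (la mu : nat -> nat) : (forall j, (mu j <= la j)%N) ->
  \prod_(j <- s) b_wt (la j) (mu j)
  = y ^+ (\sum_(j <- s) (mu j < la j))%N
    * beta ^+ (\sum_(j <- s) (la j - mu j) - \sum_(j <- s) (mu j < la j))%N.
Proof.
move=> h; rewrite -sumnB => [|j _]; last by have := h j; lia.
elim: s => [|j s IH]; first by rewrite !big_nil !expr0 mulr1.
rewrite !big_cons IH !exprD /b_wt; have := h j; case: ltnP => hj hj'.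
  by rewrite subn1 expr1; ring.
have -> : mu j = la j by lia.
by rewrite eqxx subnn sub0n !expr0 !mul1r.
Qed.

Lemma prod_b_wt0 (s : seq nat) (la mu : nat -> nat) j : j \in s -> (la j < mu j)%N ->
  \prod_(j <- s) b_wt (la j) (mu j) = 0.
Proof.
move=> hj h; rewrite (big_rem j) //= {1}/b_wt ltnNge ltnW //= gtn_eqF ?mul0r //.
Qed.

Lemma not_subpart (eta nu : intpart) : ~~ subpart eta nu ->
  exists j, (collen nu j < collen eta j)%N.
Proof.
move=> /subpartP h; apply: contrapT => hn; apply: h => j; rewrite leqNgt; apply/negP => hj.
by apply: hn; exists j.
Qed.

(** In decreasing order the inequality of [desc_entries] follows from the inclusion of [eta] in
    [nu], so every subpartition occurs. *)
Lemma B_entry N (nu eta : intpart) : (head 0 nu <= N)%N ->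
  mcoeff eta (B_cols beta y (iota 0 N) << nu >>)
  = if subpart eta nu
    then y ^+ skew_cols nu eta * beta ^+ (skew_size nu eta - skew_cols nu eta) else 0.
Proof.
move=> hN.
have := @desc_entries R (fun j => b_op beta y j) (fun old _ new => b_wt old new) b_entries 0 N nu eta.
rewrite -[foldr _ _ _]/(B_cols beta y (iota 0 N) << nu >>) => ->.
case: (boolP (subpart eta nu)) => [/subpartP h|/not_subpart [j hj]].
  rewrite asboolT; first by rewrite (prod_b_wt _ h) -skew_colsE // -skew_sizeE.
  split=> j hj; last by apply: leq_trans (collenS _ _) _.
  by have := h j; rewrite (@collen0 nu); lia.
case: asboolP => // -[h1 _]; apply: (prod_b_wt0 (j := j)) => //.
rewrite mem_iota; apply/negPn/negP => hn.
by have := h1 j hn; lia.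
Qed.
End LocalEntriesB.

Section LocalEntriesBi.
Variables (R : comNzRingType) (t y : R).
(** The column weights have the same shape as for [B], but increasing order imposes
    [collen la j.+1 <= collen mu j], the vertical strip condition. *)
Lemma Binv_entry N (la mu : intpart) : (head 0 la <= N)%N ->
  mcoeff mu (Binv_cols t y (iota 0 N) << la >>)
  = if vstrip la mu
    then (- y) ^+ skew_cols la mu * t ^+ (skew_size la mu - skew_cols la mu) else 0.
Proof.
move=> hN.
have := @asc_entries R (fun j => b_op t (- y) j) (fun old _ new => b_wt t (- y) old new)
  (b_entries t (- y)) 0 N la mu.
rewrite -[foldl _ _ _]/(Binv_cols t y (iota 0 N) << la >>) => ->.
case: vstripP => h.
  rewrite asboolT; first by rewrite prod_b_wt -?skew_colsE // -?skew_sizeE // => j; case: (h j).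
  split=> j hj; last by case: (h j).
  by have := h j; rewrite (@collen0 la); lia.
case: asboolP => // -[h1 h2].
have [] : exists j, (collen la j < collen mu j)%N; last first.
  move=> j hj; apply: (prod_b_wt0 _ _ (j := j)) => //.
  by rewrite mem_iota; apply/negPn/negP => hn; have := h1 j hn; lia.
apply: contrapT => hn; apply: h => j; split.
  by rewrite leqNgt; apply/negP => hj; apply: hn; exists j.
case: (ltnP j N) => hj; first by apply: h2; lia.
by rewrite (@collen0 la j.+1) //; lia.
Qed.
End LocalEntriesBi.

Section LocalEntriesA.
Variables (R : comNzRingType) (beta x : R).
(** [a_wt] allows at most one new box per column, and each unchanged column with a corner
    contributes [1 - beta * x]. *)
Lemma A_entry N (la mu : intpart) : (head 0 la <= N)%N ->
  mcoeff la (A_cols beta x (iota 0 N) << mu >>)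
  = if hstrip la mu
    then x ^+ skew_size la mu * (1 - beta * x) ^+ free_corners la mu else 0.
Proof.
move=> hN.
have := @asc_entries R (fun j => a_op beta x j) (a_wt beta x) (a_entries beta x) 0 N mu la.
rewrite -[foldl _ _ _]/(A_cols beta x (iota 0 N) << mu >>) => ->.
case: hstripP => h.
  have hs : subpart mu la by apply/subpartP => j; have := h j; lia.
  have hmu : (head 0 mu <= N)%N.
    by rewrite head_collen; have := h N; rewrite (@collen0 la); lia.
  rewrite asboolT; last first.
    split=> j hj; first by have := h j; rewrite (@collen0 la); lia.
    by apply: leq_trans (collenS _ _) _; have := h j; lia.
  rewrite (free_cornersE hmu hs) (skew_sizeE _ hN).
  elim: (iota 0 N) => [|j s IH]; first by rewrite !big_nil !expr0 mulr1.
  rewrite !big_cons IH !exprD /a_wt; have := h j.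
  case: (eqVneq (collen la j) (collen mu j).+1) => e hj.
    rewrite e (_ : _.+1 - _ = 1)%N; last by lia.
    by rewrite (gtn_eqF (ltnSn _)) andbF expr0 expr1 mul1r mulrA.
  have e' : collen la j = collen mu j by lia.
  rewrite e' eqxx subnn expr0 mul1r andbT.
  by case: ltnP => _; rewrite ?mulr1 ?mulr0 ?subr0 /= ?expr1 ?expr0; ring.
case: asboolP => // -[h1 h2].
have [] : exists j, ~~ (collen mu j <= collen la j <= (collen mu j).+1)%N; last first.
  move=> j hj.
  rewrite (big_rem j) /=; first by rewrite {1}/a_wt !ifF ?mul0r //; lia.
  by rewrite mem_iota; apply/negPn/negP => hn; have := h1 j hn; lia.
apply: contrapT => hn; apply: h => j.
by apply/negPn/negP => hj; apply: hn; exists j.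
Qed.
End LocalEntriesA.

Section LocalEntriesAi.
Variables (R : comNzRingType) (q x : R) (K : nat).
Hypothesis (xP : x ^+ K.+1 = 0).
Local Notation RP := {malg R[intpart]}.

Definition ainv_wt (old next new : nat) : R :=
  if (old <= new)%N then (- (q * x)) ^+ (new - old) * q ^+ (next < old)%N else 0.

Lemma ainv_entries j la ka : mcoeff ka (ainv_op K q x j << la >>)
  = if `[< off_col j la ka >] then ainv_wt (collen la j) (collen la j.+1) (collen ka j) else 0.
Proof.
rewrite ainv_op.unlock.
have -> : ainv_diag q j << la >> = q ^+ (collen la j.+1 < collen la j)%N *: << la >> + 0.
  rewrite addr0 ainv_diag.unlock full_opE /=; have := collenS la j.
  case: ltnP => h h'.
    by rewrite ifF; [rewrite expr1; move: << la >> => v; mring | lia].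
  rewrite ifT; last by lia.
  by rewrite expr0; move: << la >> => v; mring.
rewrite raddf_sum /=.
under eq_bigr => k _.
  rewrite mcoeffZ iter_u_is_linear (_ : iter k (u_op j) 0 = 0); last first.
    by elim: (k) => //= m ->; rewrite (linear0 (u_op j)).
  rewrite addr0 mcoeffZ iter_u_entries.
  over.
case: asboolP => [h|h]; last by rewrite big1 // => k _; rewrite !mulr0.
rewrite /ainv_wt; case: (leqP (collen la j) (collen ka j)) => h'; last first.
  rewrite big1 // => k _; rewrite (_ : (collen ka j == _) = false) ?mulr0 //.
  by lia.
case: (ltnP (collen ka j - collen la j) K.+1) => hK.
  rewrite (bigD1_seq (collen ka j - collen la j)%N) ?iota_uniq //=; last first.
    by rewrite mem_index_iota; lia.
  rewrite (_ : collen ka j == _) ?mulr1; last by lia.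
  rewrite big1 ?addr0 // => k hk; rewrite (_ : (collen ka j == _) = false) ?mulr0 //.
  by lia.
rewrite big1_seq => [|k]; last first.
  rewrite mem_index_iota => hk; rewrite (_ : (collen ka j == _) = false) ?mulr0 //.
  by lia.
have hz : (- (q * x)) ^+ K.+1 = 0 by rewrite exprNn exprMn xP !mulr0.
by rewrite -(subnK hK) exprD hz mulr0 mul0r.
Qed.

Definition Ainv_cols (s : seq nat) (v : RP) : RP := foldr (ainv_op K q x) v s.

Lemma Ainv_cols_is_linear s : linear (Ainv_cols s).
Proof.
elim: s => // j s IH c v w.
rewrite -[LHS]/(ainv_op K q x j (Ainv_cols s (c *: v + w))) IH; exact: (linearP (ainv_op K q x j)).
Qed.
HB.instance Definition _ s :=
  GRing.isLinear.Build R RP RP *:%R (Ainv_cols s) (Ainv_cols_is_linear s).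

(** Decreasing order imposes the vertical strip condition [collen nu j.+1 <= collen eta j]; the
    columns where it is strict give the powers of [q], counted by [free_corners_conjE]. *)
Lemma Ainv_entry N (nu eta : intpart) : (head 0 nu <= N)%N ->
  mcoeff nu (Ainv_cols (iota 0 N) << eta >>)
  = if vstrip nu eta
    then (- (q * x)) ^+ skew_size nu eta
         * q ^+ free_corners (conj_part nu) (conj_part eta) else 0.
Proof.
move=> hN.
have := @desc_entries R (fun j => ainv_op K q x j) ainv_wt ainv_entries 0 N eta nu.
rewrite -[foldr _ _ _]/(Ainv_cols (iota 0 N) << eta >>) => ->.
case: vstripP => h.
  have hs : subpart eta nu by apply/subpartP => j; case: (h j).
  have heta : (head 0 eta <= N)%N.
    by rewrite head_collen; have := h N; rewrite (@collen0 nu); lia.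
  rewrite asboolT; last first.
    split=> j hj; last by case: (h j).
    by have := h j; rewrite (@collen0 nu); lia.
  rewrite (free_corners_conjE heta hs) (skew_sizeE _ hN).
  elim: (iota 0 N) => [|j s IH]; first by rewrite !big_nil !expr0 mulr1.
  rewrite !big_cons IH !exprD /ainv_wt ifT; last by case: (h j).
  by rewrite mulrACA.
case: asboolP => // -[h1 h2].
have [] : exists j, (collen nu j < collen eta j)%N; last first.
  move=> j hj.
  rewrite (big_rem j) /=; first by rewrite {1}/ainv_wt ifF ?mul0r //; lia.
  by rewrite mem_iota; apply/negPn/negP => hn; have := h1 j hn; lia.
apply: contrapT => hn; apply: h => j; split.
  by rewrite leqNgt; apply/negP => hj; apply: hn; exists j.
case: (ltnP j N) => hj; first by apply: h2; lia.
by rewrite (@collen0 nu j.+1) //; lia.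
Qed.

Lemma A_colsK (beta : R) s v : q * (1 - beta * x) = 1 -> Ainv_cols s (A_cols beta x s v) = v.
Proof.
move=> qP; elim: s v => // j s IH v.
by rewrite -[LHS]/(ainv_op K q x j (Ainv_cols s (A_cols beta x s (a_op beta x j v)))) IH a_opK.
Qed.

End LocalEntriesAi.

(** * Generalized binomial coefficients and finite sums *)

Lemma PoszS (n : nat) : n.+1%:Z = n%:Z + 1.
Proof. by rewrite intS addrC. Qed.

Definition ffactz (t : int) (m : nat) : int := \prod_(i < m) (t - i%:Z).

Lemma ffactzS t m : ffactz t m.+1 = ffactz t m * (t - m%:Z).
Proof. by rewrite /ffactz big_ord_recr. Qed.

Lemma ffactz_shift t m : ffactz (t + 1) m.+1 = (t + 1) * ffactz t m.
Proof.
rewrite /ffactz big_ord_recl subr0; congr (_ * _); apply: eq_bigr => i _.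
by rewrite lift0 PoszS; ring.
Qed.

Lemma ffactz_diff t m : ffactz (t + 1) m.+1 = ffactz t m.+1 + m.+1%:Z * ffactz t m.
Proof. by rewrite ffactz_shift ffactzS PoszS; ring. Qed.

(** The difference equation [ffactz_diff] carries divisibility from [t] to [t + 1] and back,
    starting from [t = 0], where the product vanishes. *)
Lemma dvdz_fact_ffactz t m : ((m`!)%:Z %| ffactz t m)%Z.
Proof.
elim: m t => [|m IH] t; first by rewrite /ffactz big_ord0 fact0 dvdzz.
have hd u : ((m.+1`!)%:Z %| m.+1%:Z * ffactz u m)%Z.
  by rewrite factS PoszM dvdz_mul.
elim/int_rect: t => [|t IHt|t IHt].
- by rewrite /ffactz big_ord_recl /= subrr mul0r dvdz0.
- by rewrite PoszS ffactz_diff rpredD.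
have := ffactz_diff (- t.+1%:Z) m.
have -> : - t.+1%:Z + 1 = - t%:Z by rewrite PoszS; ring.
move=> e; rewrite (_ : ffactz (- t.+1%:Z) m.+1 = ffactz (- t%:Z) m.+1 - m.+1%:Z * ffactz (- t.+1%:Z) m).
  by rewrite rpredB.
by rewrite e addrK.
Qed.

Lemma binz_fact t (m : nat) : binz t m * (m`!)%:Z = ffactz t m.
Proof. exact: divzK (dvdz_fact_ffactz t m). Qed.

Lemma binz0 t : binz t 0%N = 1.
Proof. by rewrite /binz big_ord0 fact0 divzz. Qed.

Lemma binz_pascal t (m : nat) : binz (t + 1) m.+1 = binz t m.+1 + binz t m.
Proof.
have nz : (m.+1`!)%:Z != 0 by rewrite eqz_nat -lt0n fact_gt0.
apply: (mulIf nz); rewrite mulrDl !binz_fact ffactz_diff; congr (_ + _).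
by rewrite factS PoszM mulrCA binz_fact.
Qed.

Lemma binz_nat (a m : nat) : binz a m = 'C(a, m).
Proof.
elim: a m => [|a IH] [|m]; rewrite ?binz0 ?bin0 //.
  by rewrite /binz big_ord_recl /= subrr mul0r div0z.
by rewrite PoszS binz_pascal !IH binS PoszD.
Qed.

Lemma signz (a b : nat) : (-1 : int) ^ (a%:Z - b%:Z) = (-1) ^+ (a + b).
Proof.
have h2 (c d : nat) : (d <= c)%N -> (-1 : int) ^+ (c - d) = (-1) ^+ (c + d).
  by move=> h; rewrite -[LHS]signr_odd oddB // -oddD signr_odd.
case: (leqP b a) => h; first by rewrite subzn // -exprnP h2.
rewrite -opprB subzn; last exact: ltnW.
by rewrite -invr_expz -exprnP invr_sign h2 1?addnC // ltnW.
Qed.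

(** * Truncated binomial series with integer exponent *)

Section BinomialSeries.
Variables (S : comNzRingType) (z q : S) (K : nat).
Hypotheses (zP : z ^+ K.+1 = 0) (qP : q * (1 + z) = 1).

Definition binz_series (e : int) : S := \sum_(0 <= j < K.+1) (binz e j)%:~R * z ^+ j.

(** Pascal's rule term by term; the product by [z] overshoots only in degree [K.+1], where [z]
    vanishes. *)
Lemma binz_seriesD1 e : binz_series (e + 1) = (1 + z) * binz_series e.
Proof.
rewrite mulrDl mul1r {1 2}/binz_series big_nat_recl // [in RHS]big_nat_recl // !binz0.
rewrite -addrA; congr (_ + _); rewrite /binz_series mulr_sumr [X in _ = _ + X]big_nat_recr //=.
have -> : z * ((binz e K)%:~R * z ^+ K) = 0 by rewrite mulrCA -exprS zP mulr0.
rewrite addr0 -big_split /=; apply: eq_bigr => j _.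
by rewrite binz_pascal intrD exprS; ring.
Qed.

Lemma binz_seriesE (a b : nat) : binz_series (a%:Z - b%:Z) = (1 + z) ^+ a * q ^+ b.
Proof.
have ha : binz_series a = (1 + z) ^+ a.
  elim: a => [|a IH]; last by rewrite PoszS binz_seriesD1 IH exprS.
  rewrite /binz_series big_nat_recl // binz0 expr0 mulr1 big1 ?addr0 // => j _.
  by rewrite binz_nat bin0n mul0r.
elim: b => [|b IH]; first by rewrite subr0 ha expr0 mulr1.
rewrite exprSr mulrA -IH (_ : a%:Z - b%:Z = a%:Z - b.+1%:Z + 1).
  by rewrite binz_seriesD1 mulrC mulrA qP mul1r.
by rewrite PoszS; ring.
Qed.
End BinomialSeries.

(** Padded by zeros, such a partition is an [a]-tuple of numbers at most [b]. The finite set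
    obtained serves as a common index set for the sums over partitions. *)
Lemma part_box (a b : nat) : exists D : {fset intpart},
  forall la : intpart, (collen la 0 <= a)%N -> (head 0 la <= b)%N -> la \in D.
Proof.
exists [fset la in pmap (insub : seq nat -> option intpart)
   [seq [seq x <- map val (val t) | (0 < x)%N] | t : a.-tuple 'I_b.+1]]%fset => la ha hb.
rewrite inE mem_pmap; apply/mapP; exists (val la); last by rewrite valK.
have hsz : (size la <= a)%N.
  rewrite -(count_predT la); apply: leq_trans ha; rewrite (@eq_in_count _ _ (ltn 0)) //.
  by move=> x hx /=; rewrite lt0n; apply/esym/negP => /eqP e; case/negP: (part_pos la); rewrite -e.
have hnth i : (nth 0 la i <= b)%N.
  by apply: leq_trans hb; rewrite -nth0; elim: i => // i; apply: leq_trans; apply: part_nth.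
apply/mapP; exists [tuple inord (nth 0%N la i) | i < a]; rewrite ?mem_enum //=.
rewrite -map_comp (eq_map (_ : _ =1 (fun i : 'I_a => nth 0%N la i))); last first.
  by move=> i; rewrite /= inordK // ltnS.
rewrite (map_comp (nth 0%N la) (@nat_of_ord a)) val_enum_ord.
rewrite -(subnKC hsz) iotaD map_cat filter_cat [X in _ ++ X](_ : _ = [::]); last first.
  apply/eqP; rewrite -size_eq0 size_filter -leqn0 leqNgt -has_count; apply/hasPn => x.
  by case/mapP => i; rewrite mem_iota => hi ->; rewrite nth_default //; lia.
rewrite cats0 [X in filter _ X](_ : _ = la :> seq nat); last by rewrite -/(mkseq _ _) mkseq_nth.
apply/esym/all_filterP/allP => x hx; rewrite lt0n; apply/negP => /eqP e.
by case/negP: (part_pos la); rewrite -e.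
Qed.

Lemma fsum_box (T : choiceType) (V : zmodType) (A : set (T * T)) (F : T * T -> V) (D : {fset T}) :
  (forall p, A p -> F p != 0 -> p.1 \in D /\ p.2 \in D) ->
  \sum_(p \in A) F p = \sum_(a <- D) \sum_(b <- D) if `[< A (a, b) >] then F (a, b) else 0.
Proof.
move=> h; rewrite fsbig_mkcond.
pose r := [seq (a, b) | a <- enum_fset D, b <- enum_fset D].
have ur : uniq r by apply: allpairs_uniq => // -[? ?] [? ?].
rewrite -(@fsbig_widen _ _ _ _ [set` r]) //=.
  rewrite -fsbig_seq // big_allpairs; apply: eq_bigr => a _; apply: eq_bigr => b _.
  rewrite /functions.patch; case: asboolP => hA; first by rewrite mem_set.
  by rewrite memNset.
move=> p [_ /= /negP hp]; rewrite /functions.patch /=; case: ifP => // /set_mem hA.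
apply/eqP/negPn/negP => /(h _ hA) [h1 h2]; case/negP: hp.
by apply/allpairsP; exists p; case: p h1 h2 {hA}.
Qed.

(** * Change of scalars and several variables *)

Section BaseChange.
Variables (R S : comNzRingType) (phi : {rmorphism R -> S}).

(** This lets the operators act over a ring with an additional variable [t] or [w], while [G] and
    [g] are defined over [Zbx n]. *)
Definition base_change (v : {malg R[intpart]}) (v' : {malg S[intpart]}) : Prop :=
  forall la, mcoeff la v' = phi (mcoeff la v).
Local Notation "v ~> w" := (base_change v w) (at level 70).

Lemma bc_basis la : << la >> ~> << la >>.
Proof. by move=> k; rewrite !mcoeff_basis rmorph_nat. Qed.

Lemma bc0 : 0 ~> 0.
Proof. by move=> k; rewrite !mcoeff0 rmorph0. Qed.

Lemma bcD v v' w w' : v ~> v' -> w ~> w' -> v + w ~> v' + w'.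
Proof. by move=> h h' k; rewrite !mcoeffD rmorphD h h'. Qed.

Lemma bcN v v' : v ~> v' -> - v ~> - v'.
Proof. by move=> h k; rewrite !mcoeffN rmorphN h. Qed.

Lemma bcZ c v v' : v ~> v' -> c *: v ~> phi c *: v'.
Proof. by move=> h k; rewrite !mcoeffZ rmorphM h. Qed.

Lemma bc_lin_ext F F' v v' :
  (forall la, F la ~> F' la) -> v ~> v' -> lin_ext F v ~> lin_ext F' v'.
Proof.
move=> hF hv k.
rewrite (mcoeff_lin_ext F k (fsubsetUl (msupp v) (msupp v'))).
rewrite (mcoeff_lin_ext F' k (fsubsetUr (msupp v) (msupp v'))).
by rewrite rmorph_sum; apply: eq_bigr => la _; rewrite rmorphM hF hv.
Qed.

Lemma bc_basis_or0 o : basis_or0 R o ~> basis_or0 S o.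
Proof. by case: o => [la|]; [apply: bc_basis | apply: bc0]. Qed.

Lemma bc_u j v v' : v ~> v' -> u_op j v ~> u_op j v'.
Proof. by apply: bc_lin_ext => la; apply: bc_basis_or0. Qed.

Lemma bc_d j v v' : v ~> v' -> d_op j v ~> d_op j v'.
Proof. by apply: bc_lin_ext => la; apply: bc_basis_or0. Qed.

Lemma bc_iter_d j k v v' : v ~> v' -> iter k (d_op j) v ~> iter k (d_op j) v'.
Proof. by move=> h; elim: k => //= k; apply: bc_d. Qed.

Variable beta : R.

Lemma bc_ut j v v' : v ~> v' -> ut_op beta j v ~> ut_op (phi beta) j v'.
Proof. by move=> h; apply: bc_u; apply: bcD => //; apply: bcN; apply: bcZ; apply: bc_d. Qed.

Lemma bc_dt j v v' : v ~> v' -> dt_op beta j v ~> dt_op (phi beta) j v'.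
Proof.
apply: bc_lin_ext => la; elim: (index_iota _ _) => [|k s IH]; first by rewrite !big_nil; apply: bc0.
rewrite !big_cons; apply: bcD => //; rewrite -rmorphXn; apply: bcZ; apply: bc_iter_d.
exact: bc_basis.
Qed.

Lemma bc_A N x v v' : v ~> v' -> A_op beta N x v ~> A_op (phi beta) N (phi x) v'.
Proof.
rewrite /A_op; elim: (iota 0 N) v v' => //= j s IH v v' h; apply: IH.
by apply: bcD => //; apply: bcZ; apply: bc_ut.
Qed.

Lemma bc_B x v v' : v ~> v' -> B_op beta x v ~> B_op (phi beta) (phi x) v'.
Proof.
apply: bc_lin_ext => la; elim: (iota 0 _) => [|j s IH] /=; first exact: bc_basis.
by apply: bcD => //; apply: bcZ; apply: bc_dt.
Qed.

Lemma bc_foldl (I : Type) (f : I -> {malg R[intpart]} -> {malg R[intpart]}) f' s v v' :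
  (forall i w w', w ~> w' -> f i w ~> f' i w') -> v ~> v' ->
  foldl (fun v i => f i v) v s ~> foldl (fun v i => f' i v) v' s.
Proof. by move=> hf; elim: s v v' => //= i s IH v v' h; apply/IH/hf. Qed.

End BaseChange.

(** * Products over several variables *)

Section MultiVariable.
Variables (R : comNzRingType) (beta : R) (I : Type) (x : I -> R).
Local Notation RP := {malg R[intpart]}.

Definition A_multi (N : nat) (s : seq I) (v : RP) : RP := foldl (fun v i => A_op beta N (x i) v) v s.
Definition B_multi (N : nat) (s : seq I) (v : RP) : RP :=
  foldl (fun v i => B_cols beta (x i) (iota 0 N) v) v s.

Lemma A_multi_cons N i s v : A_multi N (i :: s) v = A_multi N s (A_cols beta (x i) (iota 0 N) v).
Proof. by rewrite -A_opE. Qed.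
Lemma B_multi_cons N i s v : B_multi N (i :: s) v = B_multi N s (B_cols beta (x i) (iota 0 N) v).
Proof. by []. Qed.

Lemma A_multi_is_linear N s : linear (A_multi N s).
Proof.
elim: s => // i s IH c v w.
by rewrite !A_multi_cons (linearP (A_cols beta (x i) (iota 0 N))) IH.
Qed.
Lemma B_multi_is_linear N s : linear (B_multi N s).
Proof.
elim: s => // i s IH c v w.
by rewrite !B_multi_cons (linearP (B_cols beta (x i) (iota 0 N))) IH.
Qed.
HB.instance Definition _ N s :=
  GRing.isLinear.Build R RP RP *:%R (A_multi N s) (A_multi_is_linear N s).
HB.instance Definition _ N s :=
  GRing.isLinear.Build R RP RP *:%R (B_multi N s) (B_multi_is_linear N s).

(* [supp_in a b v]: v is supported on partitions with at most a rows and b columns. *)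
Definition supp_in (a b : nat) (v : RP) : Prop :=
  forall la, mcoeff la v != 0 -> (collen la 0 <= a)%N /\ (head 0 la <= b)%N.

Lemma supp_in_linear (f : {linear RP -> RP}) a b a' b' v :
  (forall mu, (collen mu 0 <= a)%N -> (head 0 mu <= b)%N -> supp_in a' b' (f << mu >>)) ->
  supp_in a b v -> supp_in a' b' (f v).
Proof.
move=> hf hv la; apply: contraNP => hn; apply/eqP; apply: mcoeff_linear0 => mu.
case: (eqVneq (mcoeff mu v) 0) => [->|/hv [h1 h2]]; first by rewrite mul0r.
by case: (eqVneq (mcoeff la (f << mu >>)) 0) => [->|/(hf _ h1 h2)//]; rewrite mulr0.
Qed.

Lemma supp_in_basis la : supp_in (collen la 0) (head 0%N la) << la >>.
Proof. by move=> mu; rewrite mcoeff_basis; case: (eqVneq la mu) => [-> //|_]; rewrite eqxx. Qed.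

Lemma supp_inW a b a' b' v : (a <= a')%N -> (b <= b')%N -> supp_in a b v -> supp_in a' b' v.
Proof. by move=> ha hb h la /h [h1 h2]; split; [apply: leq_trans ha | apply: leq_trans hb]. Qed.

Lemma subpart_head (mu la : intpart) : subpart mu la -> (head 0 mu <= head 0 la)%N.
Proof. by move=> /subpartP h; rewrite head_collen -leqn0 (leq_trans (h _)) // collen0. Qed.

Lemma supp_in_B_cols a b N y v : (b <= N)%N -> supp_in a b v -> supp_in a b (B_cols beta y (iota 0 N) v).
Proof.
move=> hN; apply: supp_in_linear => mu h1 h2 la /=; rewrite B_entry; last exact: leq_trans hN.
case: ifP => [h _|]; last by rewrite eqxx.
split; last exact: leq_trans (subpart_head h) h2.
by move/subpartP: h => /(_ 0%N) /leq_trans; apply.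
Qed.

(** The factor of column 0 adds at most one box there, so at most one row appears; columns from [N]
    on are left alone. *)
Lemma supp_in_A_cols a b N z v : (b <= N)%N -> supp_in a b v -> supp_in a.+1 N (A_cols beta z (iota 0 N) v).
Proof.
move=> hN; apply: supp_in_linear => mu h1 h2 la /=.
have := @asc_entries R (fun j => a_op beta z j) (a_wt beta z) (a_entries beta z) 0 N mu la.
rewrite -[foldl _ _ _]/(A_cols beta z (iota 0 N) << mu >>) => ->.
case: asboolP => [[h3 _]|]; rewrite ?eqxx // => hp.
have hla : (head 0 la <= N)%N.
  by rewrite head_collen h3 ?collen0 ?(leq_trans h2) //; lia.
split=> //; case: N hN h3 hp hla => [|N] hN h3 hp hla.
  by rewrite h3 //; lia.
move: hp; rewrite /= big_cons /a_wt; case: (eqVneq (collen la 0) (collen mu 0).+1) => [-> _|_]; first by lia.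
by case: (eqVneq (collen la 0) (collen mu 0)) => [-> _|_]; [lia | rewrite mul0r eqxx].
Qed.

Lemma supp_in_A_multi a b N s v : (b <= N)%N -> supp_in a b v -> supp_in (a + size s) N (A_multi N s v).
Proof.
move=> hN hv; have {hv} : supp_in a N v by apply: supp_inW hv.
elim: s a v => [|i s IH] a v hv; first by rewrite addn0.
by rewrite A_multi_cons /= -addSnnS; apply: IH; apply: supp_in_A_cols hv.
Qed.

Lemma mcoeff_full j la (v : RP) : mcoeff la (full_op j v)
  = if (0 < j)%N && (collen la j.-1 == collen la j) then mcoeff la v else 0.
Proof.
rewrite (@mcoeff_linear1 R (full_op j) v la la) /=.
  by rewrite full_opE (fun_if (mcoeff la)) mcoeff_basis mcoeff0 eqxx; case: ifP; rewrite ?mulr1 ?mulr0.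
move=> mu hmu; rewrite full_opE (fun_if (mcoeff la)) mcoeff_basis mcoeff0 (negPf hmu).
by case: ifP; rewrite mulr0.
Qed.

Lemma full_head N (la : intpart) : (head 0 la < N)%N -> (0 < N)%N && (collen la N.-1 == collen la N).
Proof. by case: N => // N hN /=; rewrite !collen0 //; lia. Qed.

Lemma A_multi_agree M N s v w : (M <= N)%N ->
  (forall la : intpart, (head 0 la <= M)%N -> mcoeff la v = mcoeff la w) ->
  forall la : intpart, (head 0 la <= M)%N -> mcoeff la (A_multi N s v) = mcoeff la (A_multi N s w).
Proof.
move=> hM; elim: s v w => [|i s IH] v w hvw //.
apply: IH => la hla.
(* Both sides are compared with the operator cut after [M] factors. *)
rewrite (agree_A beta (x i) hM hvw hla).
by rewrite -(agree_A beta (x i) hM (fun l _ => erefl (mcoeff l w)) hla).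
Qed.

(** Moving [A] past [B] for one variable produces [w - z T_N w], which agrees with [(1 - z) w] on
    partitions with fewer than [N] columns; by [A_multi_agree] the coefficient of [mu] depends on no
    others. *)
Lemma Binv_A_multi_B N s t v (mu : intpart) : (head 0 mu < N)%N ->
  mcoeff mu (Binv_cols t (beta - t) (iota 0 N) (A_multi N s (B_cols beta (beta - t) (iota 0 N) v)))
  = (\prod_(i <- s) (1 - x i * (beta - t))) * mcoeff mu (A_multi N s v).
Proof.
move=> hmu; elim: s v => [|i s IH] v; first by rewrite /= B_colsK big_nil mul1r.
rewrite !A_multi_cons A_cols_B_cols IH big_cons.
set w := A_cols _ _ _ v; set z := x i * _.
rewrite (@A_multi_agree N.-1 N s _ ((1 - z) *: w)).
- by rewrite (linearZZ (A_multi N s)) mcoeffZ mulrCA mulrA.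
- exact: leq_pred.
- move=> la hla; rewrite mcoeffB !mcoeffZ mcoeff_full full_head; first by ring.
  by move: hmu hla; case: (N) => //= N'; rewrite ltnS.
by move: hmu; case: (N) => //= N'; rewrite ltnS.
Qed.

Lemma B_opE N y v a : supp_in a N v -> B_op beta y v = B_cols beta y (iota 0 N) v.
Proof.
move=> hv; rewrite [v]malg_basis (linear_sum (B_cols beta y (iota 0 N))).
rewrite /B_op (linear_sum (lin_ext _)); apply: eq_big_seq => la /=; rewrite -mcoeff_neq0 => /hv [_ hla].
rewrite (linearZZ (lin_ext _)) (linearZZ (B_cols beta y (iota 0 N))) /= lin_extU; congr (_ *: _).
have -> : foldr (fun j w => w + y *: dt_op beta j w) << la >> (iota 0 (head 0%N la))
          = B_cols beta y (iota 0 (head 0%N la)) << la >>.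
  by rewrite /B_cols b_op.unlock.
rewrite -{1}(subnKC hla) iotaD /B_cols foldr_cat; congr (foldr _ _ _).
have : {in iota (0 + head 0 la)%N (N - head 0 la)%N, forall j, collen la j = 0%N}.
  by move=> j; rewrite mem_iota => hj; apply: collen0; lia.
elim: (iota _ _) => //= j s IH h.
rewrite -IH; last by move=> i hi; apply: h; rewrite inE hi orbT.
by rewrite b_op.unlock (@dtE _ beta j la 0) ?h ?inE ?eqxx // big_geq // scaler0 addr0.
Qed.

Lemma foldl_B_op N a s v : supp_in a N v ->
  foldl (fun v i => B_op beta (x i) v) v s = B_multi N s v.
Proof.
elim: s v => //= i s IH v hv; rewrite (B_opE _ hv) IH //.
exact: supp_in_B_cols.
Qed.

Variables (w : R) (K : nat).
Hypothesis wP : w ^+ K.+1 = 0.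

(** Reaching more than [b + K] columns takes more than [K] new boxes, and the entry then contains
    [w ^+ K.+1]. *)
Lemma supp_in_A_cols_nil a b N v : (b + K <= N)%N ->
  supp_in a b v -> supp_in a.+1 (b + K) (A_cols beta w (iota 0 N) v).
Proof.
move=> hN; apply: supp_in_linear => mu h1 h2 la /= hne.
have [h3 h4] : (collen la 0 <= (collen mu 0).+1)%N /\ (head 0 la <= N)%N.
  apply: supp_in_A_cols hne; last exact: supp_in_basis.
  by apply: leq_trans hN; apply: leq_trans (leq_addr _ _).
split; first by lia.
rewrite leqNgt; apply/negP => hlt; case/eqP: hne; rewrite A_entry //.
case: ifP => // _.
have hsz : (K < skew_size la mu)%N by have := skew_size_head la mu; lia.
by rewrite -(subnK hsz) exprD wP mulr0 mul0r.
Qed.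

Lemma A_cols_B_multi a b N s v : (b + K < N)%N -> supp_in a b v ->
  A_cols beta w (iota 0 N) (B_multi N s v)
  = (\prod_(i <- s) (1 - x i * w)) *: B_multi N s (A_cols beta w (iota 0 N) v).
Proof.
move=> hN; elim: s v => [|i s IH] v hv; first by rewrite /= big_nil scale1r.
rewrite !B_multi_cons IH; last by apply: supp_in_B_cols => //; lia.
have hs := supp_in_A_cols_nil (ltnW hN) hv.
rewrite A_cols_B_cols; move: (A_cols beta w _ v) hs => u hs.
have -> : full_op N u = u.
  apply/malgP => la; rewrite mcoeff_full.
  case: (eqVneq (mcoeff la u) 0) => [->|/hs [_ h]]; first by case: ifP.
  by rewrite full_head //; lia.
have -> : u - (w * x i) *: u = (1 - x i * w) *: u by mring.
rewrite (linearZZ (B_cols _ _ _)) (linearZZ (B_multi N s)) scalerA big_cons.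
by congr (_ *: _); apply: mulrC.
Qed.

End MultiVariable.

(** * The Pieri rule for G *)

Section SkewFacts.
Implicit Types la mu : intpart.

Lemma skew_cols_le_size la mu : (skew_cols la mu <= skew_size la mu)%N.
Proof. by rewrite /skew_cols (leq_trans (size_undup _)) // size_map. Qed.

Lemma skew_cols_eq0 la mu : skew_cols la mu = 0%N -> skew_size la mu = 0%N.
Proof.
by rewrite /skew_cols /skew_size => /size0nil /undup_nil; case: (skew la mu).
Qed.

Lemma skew_size_eq0 la mu : subpart mu la -> skew_size la mu = 0%N -> la = mu.
Proof.
move=> /subpartP h /size0nil e; apply: collen_inj => j; apply/eqP; rewrite eqn_leq h andbT leqNgt.
by apply/negP => hj; have := mem_skew la mu (collen mu j) j; rewrite e in_nil hj leqnn.
Qed.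

Lemma skewxx la : skew la la = [::].
Proof.
by apply/eqP; rewrite -size_eq0 size_filter -leqn0 leqNgt -has_count; apply/hasPn => b; rewrite negbK.
Qed.

Lemma subpart_refl la : subpart la la. Proof. by apply/subpartP. Qed.

Lemma vstrip_refl la : vstrip la la.
Proof. by apply/vstripP => j; rewrite leqnn collenS. Qed.

Lemma vstrip_head la mu : vstrip la mu -> (head 0 la <= (head 0 mu).+1)%N.
Proof. by move=> /vstripP h; rewrite head_collen -leqn0 (leq_trans (h _).2) // collen0. Qed.

Lemma vstrip_sub la mu : vstrip la mu -> subpart mu la. Proof. by case/andP. Qed.

End SkewFacts.

Section GrothendieckBase.
Variables (n : nat) (S : comNzRingType) (phi : {rmorphism Zbx n -> S}).
Local Notation b := (mpolyC n ('X : {poly int})).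

Lemma G_base N (la mu : intpart) : (head 0 la <= N)%N ->
  phi (G n la mu) = mcoeff la (A_multi (phi b) (fun i => phi 'X_i) N (enum 'I_n) << mu >>).
Proof.
move=> hN; rewrite /G -(G_cut_stable n mu hN) /G_cut /A_multi; apply/esym.
by apply: (bc_foldl (phi := phi)) => [i v v'|]; [apply: bc_A | apply: bc_basis].
Qed.

Lemma g_base N (la mu : intpart) : (head 0 la <= N)%N ->
  phi (g n la mu) = mcoeff mu (B_multi (phi b) (fun i => phi 'X_i) N (enum 'I_n) << la >>).
Proof.
move=> hN; rewrite /g.
rewrite -(@foldl_B_op _ _ _ _ N (collen la 0)); last first.
  exact: supp_inW (leqnn _) hN (@supp_in_basis _ la).
apply/esym.
by apply: (bc_foldl (phi := phi)) => [i v v'|]; [apply: bc_B | apply: bc_basis].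
Qed.
End GrothendieckBase.

Lemma mulr_sub1 (P : pzRingType) (X A Q h u : P) :
  Q * h = u -> A = X * (u - h) -> A = X * ((Q - 1) * h).
Proof. by move=> <- ->; rewrite mulrBl mul1r. Qed.

(** Up to sign, [(X - b) ^+ c * (b - X) ^+ c'] is a positive power of [X - b], which makes the
    division by [1 - b / X] exact. *)
Lemma wt_identity (P : comNzRingType) (X b : P) (c c' s t : nat) : (0 < c + c')%N ->
  (X - b) * ((-1) ^+ c' * b ^+ t * (X - b) ^+ (c + c').-1 * X ^+ s.+1)
  = X * ((X - b) ^+ c * X ^+ s * ((b - X) ^+ c' * b ^+ t)).
Proof.
move=> h; have e : (X - b) ^+ (c + c').-1 * (X - b) = (X - b) ^+ c * (X - b) ^+ c'.
  by rewrite -exprSr prednK // exprD.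
have -> : (b - X) ^+ c' = (-1) ^+ c' * (X - b) ^+ c' by rewrite -exprNn opprB.
have -> : X * ((X - b) ^+ c * X ^+ s * ((-1) ^+ c' * (X - b) ^+ c' * b ^+ t))
  = X * X ^+ s * (-1) ^+ c' * b ^+ t * ((X - b) ^+ c * (X - b) ^+ c') by ring.
by rewrite -e exprS; ring.
Qed.

Lemma coef_XsubC_exp (P : comNzRingType) (b : P) m i :
  (('X - b%:P) ^+ m)`_i = (- b) ^+ (m - i) *+ 'C(m, i).
Proof.
rewrite addrC -polyCN exprDn coef_sum.
under eq_bigr => j _ do rewrite coefMn -rmorphXn /= coefCM coefXn.
case: (ltnP i m.+1) => hi; last first.
  rewrite big1 ?bin_small // => j _; rewrite (gtn_eqF (leq_trans (ltn_ord j) hi)).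
  by rewrite mulr0 mul0rn.
rewrite (bigD1 (Ordinal hi)) //= eqxx mulr1 big1 ?addr0 // => j /negPf hj.
by rewrite eq_sym -val_eqE /= in hj; rewrite hj mulr0 mul0rn.
Qed.

Lemma mpolyC_int n (m : int) : mpolyC n (m%:P) = m%:~R :> Zbx n.
Proof. by rewrite -{1}[m]intz !rmorph_int. Qed.

(** Both sides vanish unless [s - c < k <= s + c']; in that range the binomial theorem applies. *)
Lemma coef_wt (P : comNzRingType) (b : P) (c c' s t k : nat) :
  (c <= s)%N -> (c' <= t)%N -> (0 < c + c')%N ->
  ((-1) ^+ c' * b%:P ^+ (t - c') * ('X - b%:P) ^+ (c + c').-1 * 'X^((s - c).+1))`_k
  = ((-1) ^ (s%:Z - k%:Z) * binz (c%:Z + c'%:Z - 1) (s%:Z + c'%:Z - k%:Z))%:~R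
    * b ^+ (s + t - k).
Proof.
move=> hc hc' h0.
have -> : c%:Z + c'%:Z - 1 = (c + c').-1%:Z by lia.
rewrite signz coefMXn.
have -> : (-1) ^+ c' * b%:P ^+ (t - c') = ((-1) ^+ c' * b ^+ (t - c'))%:P.
  by rewrite rmorphM rmorph_sign rmorphXn.
rewrite coefCM coef_XsubC_exp.
case: ltnP => hk.
  have -> : s%:Z + c'%:Z - k%:Z = (s + c' - k)%:Z by lia.
  by rewrite binz_nat bin_small ?mulr0 ?mul0r //; lia.
case: (leqP k (s + c')) => hk2; last first.
  have -> : s%:Z + c'%:Z - k%:Z = Negz (k - (s + c')).-1 by lia.
  by rewrite [binz _ _]/(0 : int) mulr0 mul0r bin_small ?mulr0n ?mulr0 //; lia.
have -> : s%:Z + c'%:Z - k%:Z = (s + c' - k)%:Z by lia.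
(* Symmetry of binomial coefficients turns the lower index [k - (s - c) - 1] into [s + c' - k]. *)
rewrite binz_nat -(bin_sub (n := (c + c').-1) (m := (k - (s - c).+1))); last by lia.
have -> : ((c + c').-1 - (k - (s - c).+1) = s + c' - k)%N by lia.
rewrite intrM rmorph_sign [(- b) ^+ _]exprNn.
have e1 : (-1) ^+ c' * (-1) ^+ (s + c' - k) = (-1) ^+ (s + k) :> P.
  rewrite -exprD -[LHS]signr_odd -[RHS]signr_odd; congr (_ ^+ nat_of_bool _).
  by rewrite !oddD oddB // oddD; case: (odd c'); case: (odd s); case: (odd k).
have -> : (s + t - k = (t - c') + (s + c' - k))%N by lia.
rewrite -e1 exprD -mulr_natr -pmulrn; ring.
Qed.

Section PieriG.
Variable n : nat.
Local Notation Z := (Zbx n).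
Local Notation b := (mpolyC n ('X : {poly int})).
Local Notation bP := (b%:P : {poly Z}).
Implicit Types la mu nu eta : intpart.

Definition G_full_wt la mu nu eta : {poly Z} :=
  ('X - bP) ^+ skew_cols la mu * 'X ^+ (skew_size la mu - skew_cols la mu)
  * ((bP - 'X) ^+ skew_cols nu eta * bP ^+ (skew_size nu eta - skew_cols nu eta)).

Definition contains_box (D : {fset intpart}) (a N : nat) : Prop :=
  forall la : intpart, (collen la 0 <= a)%N -> (head 0 la <= N)%N -> la \in D.

(** This expands [Binv_A_multi_B] over the intermediate partitions. The bound [a] leaves room for
    one new row per variable, and the strict bound on [mu] for the additional column of a vertical
    strip. *)
Lemma G_skew (D : {fset intpart}) a N mu nu : contains_box D a N ->
  (head 0 mu < N)%N -> (head 0 nu <= N)%N -> (collen nu 0 + n <= a)%N ->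
  (\prod_(i < n) (1 - ('X_i)%:P * (bP - 'X))) * (G n mu nu)%:P
  = \sum_(la <- D) \sum_(eta <- D)
      if vstrip la mu && subpart eta nu then G_full_wt la mu nu eta * (G n la eta)%:P else 0.
Proof.
move=> hD hmu hnu ha.
pose phi := @polyC Z; pose x := fun i : 'I_n => phi 'X_i.
have := @Binv_A_multi_B _ (phi b) _ x N (enum 'I_n) 'X << nu >> mu hmu.
rewrite -[X in _ * mcoeff mu X]/(A_multi (phi b) x N (enum 'I_n) << nu >>).
rewrite -(@G_base n _ (@polyC Z)); last exact: ltnW.
rewrite big_enum /= => <-.
set v := A_multi _ _ _ _ _.
have hsB : supp_in (collen nu 0) N (B_cols (phi b) (phi b - 'X) (iota 0 N) << nu >>).
  by apply: supp_in_B_cols => //; apply: supp_inW (leqnn _) hnu (@supp_in_basis _ nu).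
have hs : supp_in a N v.
  apply: supp_inW (leqnn N) (@supp_in_A_multi _ (phi b) _ x _ _ _ (enum 'I_n) _ (leqnn N) hsB).
  by rewrite size_enum_ord.
rewrite (@mcoeff_linear _ (Binv_cols 'X (phi b - 'X) (iota 0 N)) v mu D) /=; last first.
  move=> la hla; suff -> : mcoeff la v = 0 by rewrite mul0r.
  by apply/eqP; apply: contraNT hla => /hs [h1 h2]; apply: hD.
apply: eq_big_seq => la _.
case: (leqP (head 0%N la) N) => hla; last first.
  have -> : mcoeff la v = 0.
    by apply/eqP; apply: contraTT hla => /hs [_]; rewrite -leqNgt.
  rewrite mul0r big1 // => eta _; case: ifP => // /andP[/vstrip_head h _].
  by move: (leq_trans h hmu); lia.
rewrite Binv_entry //.
rewrite (@mcoeff_linear _ (A_multi (phi b) x N (enum 'I_n)) _ la D) /=; last first.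
  move=> eta heta; rewrite (_ : mcoeff eta _ = 0) ?mul0r //.
  apply/eqP; apply: contraNT heta => /hsB [h1 h2]; apply: hD => //.
  by apply: leq_trans ha; apply: leq_trans (leq_addr _ _).
rewrite mulr_suml; apply: eq_bigr => eta _.
rewrite B_entry // -(@G_base n _ (@polyC Z) N la eta hla) /G_full_wt /phi opprB.
by case: (vstrip la mu); case: (subpart eta nu); rewrite /= ?mulr0 ?mul0r //; ring.
Qed.

(** Closed form of [G_full_wt], minus 1 in the diagonal case [la = mu], [eta = nu], divided by
    [1 - beta / 'X]. On the shapes of the sum, [m = 0] is the diagonal case, where the difference is
    zero. *)
Definition G_wt la mu nu eta : {poly Z} :=
  let m := (skew_cols la mu + skew_cols nu eta)%N in
  if m == 0%N then 0 else
  (-1) ^+ skew_cols nu eta * bP ^+ (skew_size nu eta - skew_cols nu eta)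
  * ('X - bP) ^+ m.-1 * 'X^((skew_size la mu - skew_cols la mu).+1).

Lemma G_wt_spec la mu nu eta : subpart mu la -> subpart eta nu ->
  ('X - bP) * G_wt la mu nu eta
  = 'X * (G_full_wt la mu nu eta - ((la == mu) && (eta == nu))%:R).
Proof.
move=> h1 h2; rewrite /G_wt; case: eqP => [/eqP|].
  rewrite addn_eq0 => /andP[/eqP e1 /eqP e2]; have s1 := skew_cols_eq0 e1; have s2 := skew_cols_eq0 e2.
  rewrite (skew_size_eq0 h1 s1) (skew_size_eq0 h2 s2) !eqxx mulr0.
  by rewrite /G_full_wt /skew_size /skew_cols !skewxx /= !expr0 !mulr1 subrr mulr0.
move=> ne; have -> : (la == mu) && (eta == nu) = false.
  by apply/negP => /andP[/eqP e1 /eqP e2]; apply: ne; rewrite e1 e2 /skew_cols !skewxx.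
rewrite mulr0n (subr0 (G_full_wt la mu nu eta)).
by apply: (@wt_identity {poly Z} 'X bP); lia.
Qed.

Lemma G_wt_coef k la mu nu eta :
  (0 < k)%N -> (G_wt la mu nu eta)`_k = mpolyC n (G_pieri_coef k la mu nu eta).
Proof.
move=> hk; rewrite /G_pieri_coef /= rmorphM rmorphXn /= mpolyC_int.
rewrite /G_wt; case: eqP => [/eqP|] h.
  move: h; rewrite addn_eq0 => /andP[/eqP e1 /eqP e2]; rewrite e1 e2 (skew_cols_eq0 e1) coef0.
  (* In the diagonal case the lower index of the binomial is [- k], negative because [k] is
     positive. *)
  have -> : 0%:Z + 0%:Z - k%:Z = Negz k.-1 by lia.
  by rewrite [binz _ (Negz _)]/(0 : int) mulr0 mul0r.
by rewrite coef_wt ?skew_cols_le_size //; lia.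
Qed.

Definition G_pieri_poly (D : {fset intpart}) mu nu : {poly Z} :=
  \sum_(la <- D) \sum_(eta <- D)
    if vstrip la mu && subpart eta nu then G_wt la mu nu eta * (G n la eta)%:P else 0.

(** Subtracting [G n mu nu] removes the diagonal term. The remaining factor on the right depends on
    [mu] and [nu] only through [G n mu nu], so comparison with the empty partitions eliminates the
    product over the variables. *)
Lemma G_pieri_polyE (D : {fset intpart}) a N mu nu : contains_box D a N ->
  (head 0 mu < N)%N -> (head 0 nu <= N)%N -> (collen nu 0 + n <= a)%N -> (collen mu 0 <= a)%N ->
  ('X - bP) * G_pieri_poly D mu nu
  = 'X * ((\prod_(i < n) (1 - ('X_i)%:P * (bP - 'X)) - 1) * (G n mu nu)%:P).
Proof.
move=> hD hmu hnu ha ha'.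
apply: (mulr_sub1 (G_skew hD hmu hnu ha)).
have hG : (G n mu nu)%:P = \sum_(la <- D) \sum_(eta <- D)
    if vstrip la mu && subpart eta nu then ((la == mu) && (eta == nu))%:R * (G n la eta)%:P else 0.
  have hmuD : mu \in D by apply: hD => //; apply: ltnW.
  have hnuD : nu \in D by apply: hD => //; apply: leq_trans ha; apply: leq_addr.
  rewrite (bigD1_seq mu) ?fset_uniq //= [X in _ + X]big1 => [|la /negPf hla]; last first.
    by rewrite big1 // => eta _; case: ifP => // _; rewrite hla mul0r.
  rewrite addr0 (bigD1_seq nu) ?fset_uniq //= [X in _ + X]big1 => [|eta /negPf heta]; last first.
    by case: ifP => // _; rewrite heta andbF mul0r.
  by rewrite vstrip_refl subpart_refl !eqxx mul1r addr0.
apply: etrans (congr1 (fun u => 'X * (_ - u)) (esym hG)).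
rewrite -sumrB /G_pieri_poly !mulr_sumr; apply: eq_bigr => la _.
rewrite -sumrB !mulr_sumr; apply: eq_bigr => eta _.
case: ifP => [/andP[h1 h2]|_]; last by rewrite subrr !mulr0.
have := G_wt_spec (vstrip_sub h1) h2.
move: (G_wt _ _ _ _) (G_full_wt _ _ _ _) ((G n la eta)%:P) (_%:R) ('X - bP) => p1 p2 p3 p4 p5 e.
by rewrite mulrA e -mulrBl mulrA.
Qed.

Lemma one_col_collen k j : collen (one_col k) j = (if j == 0%N then k else 0)%N.
Proof. by rewrite /collen /= count_nseq; case: j => [|j] /=; lia. Qed.

Lemma vstrip_empty la : vstrip la empty_part -> la = one_col (collen la 0).
Proof.
move=> /vstripP h; apply: collen_inj => j; rewrite one_col_collen; case: j => [//|j] /=.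
by have := (h j).2; rewrite collen_empty; lia.
Qed.

Lemma subpart_empty eta : subpart eta empty_part -> eta = empty_part.
Proof. by move=> /subpartP h; apply: collen_inj => j; have := h j; rewrite collen_empty; lia. Qed.

Lemma G_wt_empty k : G_wt (one_col k) empty_part empty_part empty_part = if k == 0%N then 0 else 'X^k.
Proof.
have h1 : skew_cols (one_col k) empty_part = (0 < k)%N.
  rewrite (@skew_colsE _ _ 1); last by case: (k).
  by rewrite /= big_cons big_nil one_col_collen collen_empty addn0.
have h2 : skew_size (one_col k) empty_part = k.
  rewrite (@skew_sizeE _ _ 1); last by case: (k).
  by rewrite /= big_cons big_nil one_col_collen collen_empty /=; lia.
rewrite /G_wt h1 h2 /skew_cols /skew_size !skewxx /=.
case: k {h1 h2} => [|k] //=.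
by rewrite !expr0 !mul1r subn1.
Qed.

(** A vertical strip over the empty partition is a single column, and its weight is the monomial
    ['X^k]. *)
Lemma G_pieri_poly_empty (D : {fset intpart}) k : (0 < k)%N ->
  one_col k \in D -> empty_part \in D ->
  (G_pieri_poly D empty_part empty_part)`_k = G n (one_col k) empty_part.
Proof.
move=> hk hD1 hD0; rewrite coef_sum (bigD1_seq (one_col k)) ?fset_uniq //=.
rewrite [X in _ + X]big1 => [|la hla]; last first.
  rewrite coef_sum big1 // => eta _; case: ifP => [/andP[h1 /subpart_empty h2]|_]; last by rewrite coef0.
  rewrite h2 (vstrip_empty h1) G_wt_empty; case: eqP => h; first by rewrite mul0r coef0.
  rewrite coefMC coefXn; case: eqP => e; last by rewrite mul0r.
  by case/eqP: hla; rewrite e -vstrip_empty.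
rewrite addr0 coef_sum (bigD1_seq empty_part) ?fset_uniq //=.
rewrite [X in _ + X]big1 => [|eta heta]; last first.
  by case: ifP => [/andP[_ /subpart_empty h]|_]; [rewrite h eqxx in heta | rewrite coef0].
rewrite addr0 subpart_refl andbT ifT; last first.
  by apply/vstripP => j; rewrite !one_col_collen.
by rewrite G_wt_empty gtn_eqF // coefMC coefXn eqxx mul1r.
Qed.

Theorem G_pieri k mu nu : (0 < k)%N ->
  G n (one_col k) empty_part * G n mu nu
  = \sum_(p \in [set p : intpart * intpart | vstrip p.1 mu /\ subpart p.2 nu]%classic)
      G_pieri_coef k p.1 mu nu p.2 *: G n p.1 p.2.
Proof.
move=> hk.
pose N := ((head 0 mu).+1 + head 0 nu)%N; pose a := (collen nu 0 + n + collen mu 0 + k)%N.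
have [D hD] : exists D, contains_box D a N by apply: part_box.
have D0 : empty_part \in D by apply: hD.
have Dk : one_col k \in D.
  apply: hD; first by rewrite one_col_collen /a /=; lia.
  by rewrite /N; case: (k) => [|m] /=; lia.
have h0 : (collen empty_part 0 + n <= a)%N by rewrite collen_empty /a; lia.
have e0 := @G_pieri_polyE D a N empty_part empty_part hD isT isT h0 isT.
have h1 : (head 0 mu < N)%N by rewrite /N; lia.
have h2 : (head 0 nu <= N)%N by rewrite /N; lia.
have h3 : (collen nu 0 + n <= a)%N by rewrite /a; lia.
have h4 : (collen mu 0 <= a)%N by rewrite /a; lia.
have e1 := G_pieri_polyE hD h1 h2 h3 h4.
have G00 : G n empty_part empty_part = 1.
  rewrite /G /G_cut /A_op /=.
  have -> : foldl (fun v (_ : 'I_n) => v) << empty_part >> (enum 'I_n)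
     = << empty_part >> :> {malg Z[intpart]} by elim: (enum 'I_n).
  by rewrite mcoeff_basis eqxx.
have e2 : G_pieri_poly D empty_part empty_part * (G n mu nu)%:P = G_pieri_poly D mu nu.
  (* The polynomial ['X - beta] is monic, hence regular, and can be cancelled. *)
  apply: (monic_rreg (monicXsubC b)).
  by rewrite mulrC mulrA e0 G00 mulr1 [RHS]mulrC e1 mulrA.
have := congr1 (fun p : {poly Z} => p`_k) e2.
rewrite /= coefMC G_pieri_poly_empty // => ->.
rewrite (@fsum_box _ _ _ _ D) => [|[la eta] /= [{}h1 {}h2] hne].
  rewrite coef_sum; apply: eq_bigr => la _; rewrite coef_sum; apply: eq_bigr => eta _.
  case: asboolP => /= h; last first.
    by case: ifP => [/andP|_]; [move=> h5; case: h | rewrite coef0].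
  by case: h => -> -> /=; rewrite coefMC G_wt_coef // mul_mpolyC.
have h2' : (collen eta 0 <= collen nu 0)%N by move/subpartP: h2.
have hla : (head 0 la <= N)%N by have := vstrip_head h1; rewrite /N; lia.
have heta : (head 0 eta <= N)%N by have := subpart_head h2; rewrite /N; lia.
split; last by apply: hD => //; rewrite /a; lia.
apply: hD => //.
(* A nonzero [G n la eta] bounds the rows of [la], because each of the [n] variables adds at most
   one row to [eta]. *)
have hG : G n la eta != 0 by apply: contraNneq hne => ->; rewrite scaler0.
move: hG; rewrite -[G n la eta]/(idfun (G n la eta)) (G_base _ _ hla).
move=> /(@supp_in_A_multi _ _ _ _ _ _ _ _ _ heta (@supp_in_basis _ eta)) [+ _].
by rewrite size_enum_ord /a; lia.
Qed.

End PieriG.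

(** * The Pieri rule for g *)

Lemma foldl_fix (T I : Type) (f : T -> I -> T) v s : (forall i, f v i = v) -> foldl f v s = v.
Proof. by move=> h; elim: s => //= i s IH; rewrite h. Qed.

Lemma B_op_empty (R : comNzRingType) (beta x : R) :
  B_op beta x << empty_part >> = << empty_part >>.
Proof. exact: lin_extU. Qed.

Section Pierig.
Variables (n : nat) (S : comNzRingType) (phi : {rmorphism Zbx n -> S}).
Local Notation b := (mpolyC n ('X : {poly int})).
Variables (K : nat) (w q : S).
Hypotheses (wP : w ^+ K.+1 = 0) (qP : q * (1 - phi b * w) = 1).
Implicit Types la mu nu eta : intpart.

Definition g_full_wt la mu nu eta : S :=
  w ^+ skew_size la mu * (1 - phi b * w) ^+ free_corners la mu
  * ((- (q * w)) ^+ skew_size nu eta * q ^+ free_corners (conj_part nu) (conj_part eta)).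

(** Insert [A^-1 A] in front of the product of the [B], move [A] past them by [A_cols_B_multi], and
    expand over the intermediate partitions. *)
Lemma g_skew (D : {fset intpart}) a N mu nu : contains_box D a N ->
  (head 0 mu + K < N)%N -> (head 0 nu <= N)%N -> (collen mu 0 < a)%N -> (collen nu 0 <= a)%N ->
  phi (g n mu nu) = (\prod_(i < n) (1 - phi 'X_i * w)) * (\sum_(la <- D) \sum_(eta <- D)
      if hstrip la mu && vstrip nu eta then g_full_wt la mu nu eta * phi (g n la eta) else 0).
Proof.
move=> hD hmu hnu ha ha'.
pose x := fun i : 'I_n => phi 'X_i.
have hN : (head 0 mu <= N)%N by apply: leq_trans (ltnW hmu); apply: leq_addr.
rewrite (g_base phi nu hN) -/x.
rewrite -[B_multi _ _ _ _ _](@A_colsK _ q w K wP (phi b) (iota 0 N) _ qP).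
rewrite (@A_cols_B_multi _ (phi b) _ x w K wP _ _ _ (enum 'I_n) _ hmu (@supp_in_basis _ mu)).
rewrite (linearZZ (Ainv_cols q w K (iota 0 N))) mcoeffZ big_enum /=; congr (_ * _).
set v := A_cols _ _ _ _.
have hs : supp_in a N v.
  by apply: supp_inW ha (leqnn N) (@supp_in_A_cols _ (phi b) _ _ _ w _ hN (@supp_in_basis _ mu)).
rewrite (@mcoeff_linear _ (Ainv_cols q w K (iota 0 N)) _ nu D) /=; last first.
  move=> eta heta; rewrite Ainv_entry //; case: ifP => [h|_]; last by rewrite mulr0.
  case/negP: heta; apply: hD.
    by apply: leq_trans ha'; move/vstrip_sub/subpartP: h.
  by apply: leq_trans (subpart_head (vstrip_sub h)) hnu.
rewrite exchange_big; apply: eq_big_seq => eta _ /=.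
rewrite Ainv_entry //.
rewrite (@mcoeff_linear _ (B_multi (phi b) x N (enum 'I_n)) v eta D) /=; last first.
  move=> la hla; rewrite (_ : mcoeff la v = 0) ?mul0r //.
  by apply/eqP; apply: contraNT hla => /hs [h1 h2]; apply: hD.
rewrite mulr_suml; apply: eq_bigr => la _.
case: (leqP (head 0%N la) N) => hla; last first.
  have -> : mcoeff la v = 0.
    by apply/eqP; apply: contraTT hla => /hs [_]; rewrite -leqNgt.
  rewrite !mul0r; case: ifP => // _.
  have hsz : (K < skew_size la mu)%N by have := skew_size_head la mu; lia.
  rewrite /g_full_wt (_ : w ^+ skew_size la mu = 0) ?mul0r //.
  by rewrite -(subnK hsz) exprD wP mulr0.
rewrite A_entry // -(g_base phi eta hla) /g_full_wt.
by case: (hstrip la mu); case: (vstrip nu eta); rewrite /= ?mulr0 ?mul0r //; ring.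
Qed.

(** With [z = - beta w], the powers of [1 - beta w] and [q] form the binomial series of exponent
    [a - a' - t]. Multiplied by [(-1)^t w^(s + t)], its term [j] is the term [k = s + t + j] on the
    right. *)
Lemma g_full_wtE la mu nu eta :
  g_full_wt la mu nu eta
  = \sum_(0 <= k < K.+1) w ^+ k * phi (mpolyC n (g_pieri_coef k la mu nu eta)).
Proof.
set s := skew_size la mu; set t := skew_size nu eta.
set a := free_corners la mu; set a' := free_corners (conj_part nu) (conj_part eta).
pose z := - (phi b * w).
have hz j : z ^+ j = (-1) ^+ j * (phi b ^+ j * w ^+ j) by rewrite /z [LHS]exprNn exprMn.
have zP : z ^+ K.+1 = 0 by rewrite hz wP !mulr0.
have qP' : q * (1 + z) = 1 by [].
have -> : g_full_wt la mu nu eta = (-1) ^+ t * w ^+ (s + t) * binz_series z K (a%:Z - (a' + t)%:Z).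
  rewrite (binz_seriesE zP qP') /g_full_wt -/s -/t -/a -/a' -/z.
  have -> : (- (q * w)) ^+ t = (-1) ^+ t * q ^+ t * w ^+ t by rewrite [LHS]exprNn exprMn mulrA.
  by rewrite !exprD; ring.
have e : a%:Z - (a' + t)%:Z = a%:Z - a'%:Z - t%:Z by lia.
rewrite e.
have hc k : phi (mpolyC n (g_pieri_coef k la mu nu eta))
  = (-1) ^+ (k + s) * (binz (a%:Z - a'%:Z - t%:Z) (k%:Z - s%:Z - t%:Z))%:~R * phi b ^+ (k - s - t).
  rewrite /g_pieri_coef /= -/s -/t -/a -/a' [mpolyC n _]rmorphM rmorphXn /= mpolyC_int.
  rewrite rmorphM rmorphXn rmorph_int signz.
  by rewrite intrM rmorph_sign.
under eq_bigr => k _ do rewrite hc.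
rewrite /binz_series mulr_sumr.
case: (leqP (s + t) K) => hst; last first.
  rewrite big1 => [|j _]; last first.
    by rewrite -(subnK hst) exprD wP !(mulr0, mul0r).
  rewrite big_nat big1 // => k hk.
  have -> : k%:Z - s%:Z - t%:Z = Negz ((s + t) - k).-1 by lia.
  by rewrite [binz _ (Negz _)]/(0 : int) !(mulr0, mul0r).
(* For [k < s + t] the lower index of the binomial is negative. *)
rewrite [RHS](big_cat_nat (n := (s + t)%N)) //=; last by lia.
rewrite [X in _ = X + _]big_nat [X in _ = X + _]big1 ?add0r => [|k hk]; last first.
  have -> : k%:Z - s%:Z - t%:Z = Negz ((s + t) - k).-1 by lia.
  by rewrite [binz _ (Negz _)]/(0 : int) !(mulr0, mul0r).
(* For [s + t + j > K] the term contains [w ^+ K.+1]. *)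
rewrite (big_cat_nat (n := (K.+1 - (s + t))%N)) //=; last by lia.
rewrite [X in _ + X]big_nat [X in _ + X]big1 ?addr0 => [|j hj]; last first.
  rewrite hz.
  have -> : (-1) ^+ t * w ^+ (s + t) * ((binz (a%:Z - a'%:Z - t%:Z) j)%:~R * ((-1) ^+ j * (phi b ^+ j * w ^+ j)))
    = (-1) ^+ t * (binz (a%:Z - a'%:Z - t%:Z) j)%:~R * (-1) ^+ j * phi b ^+ j * (w ^+ (s + t) * w ^+ j).
    by ring.
  have h : (K.+1 <= s + t + j)%N by lia.
  by rewrite -exprD -(subnK h) exprD wP !mulr0.
rewrite -[in RHS](add0n (s + t)%N) big_addn; apply: eq_bigr => j _.
have -> : (j + (s + t))%:Z - s%:Z - t%:Z = j%:Z by lia.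
have -> : (j + (s + t) - s - t = j)%N by lia.
have -> : (-1) ^+ (j + (s + t) + s) = (-1) ^+ t * (-1) ^+ j :> S.
  rewrite -exprD -[LHS]signr_odd -[RHS]signr_odd; congr (_ ^+ nat_of_bool _).
  by rewrite !oddD; case: (odd t); case: (odd s); case: (odd j).
by rewrite hz !exprD; ring.
Qed.

Lemma one_row_collen k j : collen (one_row k) j = (j < k)%N.
Proof. by case: k => [|k]; rewrite /collen //= addn0. Qed.

Lemma hstrip_empty la : hstrip la empty_part -> la = one_row (head 0%N la).
Proof.
move=> /hstripP h; apply: collen_inj => j; rewrite one_row_collen.
have := h j; rewrite collen_empty => hj.
case: ltnP => hl; last by rewrite collen0.
have : (0 < collen la j)%N by rewrite lt0n -head_collen -ltnNge.
by lia.
Qed.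

Lemma g_wt_empty k :
  g_full_wt (one_row k) empty_part empty_part empty_part = w ^+ k.
Proof.
have h2 : skew_size (one_row k) empty_part = k.
  rewrite (@skew_sizeE _ _ k); last by case: (k).
  rewrite big_seq (eq_bigr (fun _ => 1%N)) => [|j].
    by rewrite -big_seq sum1_size size_iota.
  by rewrite mem_iota one_row_collen collen_empty /= add0n => ->.
rewrite /g_full_wt h2 (_ : free_corners (one_row k) empty_part = 0%N) //.
rewrite (_ : free_corners (conj_part empty_part) (conj_part empty_part) = 0%N) //.
by rewrite /skew_size skewxx /= !expr0 !mulr1.
Qed.

Lemma g_empty : g n empty_part empty_part = 1.
Proof.
rewrite /g foldl_fix => [|i]; last exact: B_op_empty.
by rewrite mcoeff_basis eqxx.
Qed.

(** For empty [mu] and [nu], only single rows [la] occur in [g_skew], and those longer than [K] are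
    killed by the nilpotency of [w]. *)
Lemma g_prod (D : {fset intpart}) a N : contains_box D a N -> (K < N)%N -> (0 < a)%N ->
  (\prod_(i < n) (1 - phi 'X_i * w))
  * (\sum_(0 <= k < K.+1) w ^+ k * phi (g n (one_row k) empty_part)) = 1.
Proof.
move=> hD hN ha.
have := @g_skew D a N empty_part empty_part hD hN isT ha isT.
rewrite g_empty rmorph1 => e; apply: etrans (esym e); congr (_ * _) => {e}.
rewrite [RHS](eq_bigr (fun la => if hstrip la empty_part then
   g_full_wt la empty_part empty_part empty_part * phi (g n la empty_part) else 0)); last first.
  move=> la _; rewrite (bigD1_seq empty_part) ?fset_uniq ?hD //= vstrip_refl andbT.
  rewrite big1 ?addr0 // => eta heta; case: ifP => // /andP[_ /vstrip_sub/subpart_empty e].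
  by rewrite e eqxx in heta.
rewrite -big_mkcond /=.
have hperm : perm_eq [seq la <- D | hstrip la empty_part & (head 0 la <= K)%N]
                     [seq one_row k | k <- index_iota 0 K.+1].
  apply: uniq_perm; first by rewrite filter_uniq ?fset_uniq.
    rewrite map_inj_uniq ?iota_uniq // => i j e.
    have := one_row_collen i i; have := one_row_collen j i; have := one_row_collen i j.
    by have := one_row_collen j j; rewrite e; lia.
  move=> la; rewrite mem_filter; apply/idP/mapP.
    move=> /andP[/andP[h1 h2] _]; exists (head 0%N la); last exact: hstrip_empty.
    by rewrite mem_index_iota.
  case=> k; rewrite mem_index_iota => hk ->; apply/andP; split.
    apply/andP; split; last by case: (k) hk.
    by apply/hstripP => j; rewrite one_row_collen collen_empty; case: ltnP.
  apply: hD; first by rewrite one_row_collen; case: (k).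
  by apply: leq_trans hN; case: (k) hk => //= k'; lia.
rewrite [RHS](bigID (fun la : intpart => (head 0 la <= K)%N)) /=.
rewrite [X in _ = _ + X]big1 ?addr0 => [|la /andP[h1 h2]]; last first.
  rewrite (hstrip_empty h1) g_wt_empty.
  have hk : (K < head 0%N la)%N by rewrite ltnNge.
  by rewrite -(subnK hk) exprD wP mulr0 mul0r.
rewrite -[RHS]big_filter (perm_big _ hperm) big_map; apply: eq_bigr => k _.
by rewrite g_wt_empty.
Qed.

(** By [g_prod] the series on the left cancels the product over the variables in [g_skew]. *)
Lemma g_pieri_series (D : {fset intpart}) a N mu nu : contains_box D a N ->
  (head 0 mu + K < N)%N -> (head 0 nu <= N)%N -> (collen mu 0 < a)%N -> (collen nu 0 <= a)%N ->
  \sum_(0 <= k < K.+1) w ^+ k * phi (g n (one_row k) empty_part * g n mu nu)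
  = \sum_(0 <= k < K.+1) w ^+ k * phi (\sum_(la <- D) \sum_(eta <- D)
     if hstrip la mu && vstrip nu eta then g_pieri_coef k la mu nu eta *: g n la eta else 0).
Proof.
move=> hD hmu hnu ha ha'.
have hK : (K < N)%N by apply: leq_ltn_trans hmu; apply: leq_addl.
have hp := g_prod hD hK (leq_ltn_trans (leq0n _) ha).
have hg := g_skew hD hmu hnu ha ha'.
have -> : \sum_(0 <= k < K.+1) w ^+ k * phi (g n (one_row k) empty_part * g n mu nu)
  = \sum_(la <- D) \sum_(eta <- D)
      if hstrip la mu && vstrip nu eta then g_full_wt la mu nu eta * phi (g n la eta) else 0.
  under eq_bigr => k _ do rewrite rmorphM mulrA.
  by rewrite -mulr_suml hg mulrCA mulrA hp mul1r.
transitivity (\sum_(0 <= k < K.+1) \sum_(la <- D) \sum_(eta <- D)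
    if hstrip la mu && vstrip nu eta
    then w ^+ k * phi (mpolyC n (g_pieri_coef k la mu nu eta)) * phi (g n la eta) else 0).
  rewrite [RHS]exchange_big; apply: eq_bigr => la _; rewrite [RHS]exchange_big; apply: eq_bigr => eta _ /=.
  case: ifP => _; last by rewrite big1.
  by rewrite g_full_wtE mulr_suml.
apply: eq_bigr => k _; rewrite rmorph_sum mulr_sumr; apply: eq_bigr => la _.
rewrite rmorph_sum mulr_sumr; apply: eq_bigr => eta _.
case: ifP => _; last by rewrite rmorph0 mulr0.
by rewrite -mul_mpolyC (rmorphM phi) mulrA.
Qed.
End Pierig.

(** * Truncated polynomials in a nilpotent variable *)

Section Truncated.
Variables (A : comNzRingType) (K : nat).
Local Notation S := {poly %/ ('X^(K.+1) : {poly A})}.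
Local Notation h := ('X^(K.+1) : {poly A}).

Definition trunc_const : A -> S := in_qpoly h \o polyC.
HB.instance Definition _ := GRing.RMorphism.on trunc_const.

Lemma truncX_nil : in_qpoly h 'X ^+ K.+1 = 0.
Proof.
rewrite -rmorphXn; apply/val_inj; rewrite /= mk_monic_Xn.
by rewrite Pdiv.RingMonic.rmodpp ?monicXn.
Qed.

(** A class modulo ['X^(K.+1)] has a unique representative of degree at most [K], from which the
    coefficients are read off. *)
Lemma trunc_series_inj (c d : nat -> A) :
  \sum_(0 <= k < K.+1) in_qpoly h 'X ^+ k * trunc_const (c k)
  = \sum_(0 <= k < K.+1) in_qpoly h 'X ^+ k * trunc_const (d k) ->
  forall k, (k <= K)%N -> c k = d k.
Proof.
have hs (e : nat -> A) : \sum_(0 <= k < K.+1) in_qpoly h 'X ^+ k * trunc_const (e k)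
   = in_qpoly h (\poly_(k < K.+1) e k).
  rewrite poly_def rmorph_sum big_mkord; apply: eq_bigr => k _.
  by rewrite -mul_polyC rmorphM rmorphXn mulrC.
have hsmall (e : nat -> A) : polyn (in_qpoly h (\poly_(k < K.+1) e k)) = \poly_(k < K.+1) e k.
  by apply: in_qpoly_small; rewrite mk_monic_Xn size_polyXn ltnS; apply: size_poly.
rewrite !hs => e k hk; have := congr1 (@polyn _ _) e; rewrite !hsmall => /polyP /(_ k).
by rewrite !coef_poly ltnS hk.
Qed.

Lemma geometric_inv (R : comNzRingType) (z : R) :
  z ^+ K.+1 = 0 -> (\sum_(i < K.+1) z ^+ i) * (1 - z) = 1.
Proof.
move=> hz; have e := subrX1 z K.+1; rewrite hz sub0r in e.
by rewrite -[1 - z]opprB mulrN mulrC -e opprK.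
Qed.

End Truncated.

Theorem g_pieri n k mu nu : (0 < k)%N ->
  g n (one_row k) empty_part * g n mu nu
  = \sum_(p \in [set p : intpart * intpart | hstrip p.1 mu /\ vstrip nu p.2]%classic)
      g_pieri_coef k p.1 mu nu p.2 *: g n p.1 p.2.
Proof.
move=> hk.
pose N := ((head 0 mu + k).+1 + head 0 nu)%N; pose a := (collen nu 0 + (collen mu 0).+1)%N.
have [D hD] : exists D, contains_box D a N by apply: part_box.
have h1 : (head 0 mu + k < N)%N by rewrite /N; lia.
have h2 : (head 0 nu <= N)%N by rewrite /N; lia.
have h3 : (collen mu 0 < a)%N by rewrite /a; lia.
have h4 : (collen nu 0 <= a)%N by rewrite /a; lia.
(* Truncation after degree [k] suffices to read off the coefficient of [w ^+ k]. *)
pose phi := @trunc_const (Zbx n) k; pose w := in_qpoly ('X^(k.+1) : {poly Zbx n}) 'X.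
have wP : w ^+ k.+1 = 0 by apply: truncX_nil.
pose z := phi (mpolyC n 'X) * w.
have zP : z ^+ k.+1 = 0 by rewrite /z exprMn wP mulr0.
have qP := geometric_inv zP.
have := @g_pieri_series n _ phi k w _ wP qP D a N mu nu hD h1 h2 h3 h4.
move=> /trunc_series_inj /(_ k (leqnn k)) ->.
rewrite (@fsum_box _ _ _ _ D) => [|[la eta] /= [{}h1 {}h2] hne].
  apply: eq_bigr => la _; apply: eq_bigr => eta _.
  by case: asboolP => /= [[-> ->]//|hn]; case: ifP => // /andP.
(* Beyond this bound the binomial has a negative lower index, so only finitely many [la]
   contribute. *)
have hs : (skew_size la mu <= k)%N.
  rewrite leqNgt; apply: contraNN hne => hlt; rewrite /g_pieri_coef /=.
  rewrite (_ : k%:Z - _ - _ = Negz (skew_size la mu + skew_size nu eta - k).-1); last by lia.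
  by rewrite [binz _ (Negz _)]/(0 : int) mulr0 polyC0 mul0r scale0r.
have hla := skew_size_head la mu.
have hl0 : (collen la 0 <= (collen mu 0).+1)%N by move/hstripP: h1 => /(_ 0%N) /andP[].
have he0 : (collen eta 0 <= collen nu 0)%N by move/vstrip_sub/subpartP: h2.
have heta := subpart_head (vstrip_sub h2).
by split; apply: hD; rewrite /a /N; lia.
Qed.

Local Open Scope classical_set_scope.

Theorem theorem7p1 (k : nat) (mu nu : intpart) (n : nat) : (1 <= k)%N ->
  G n (one_col k) empty_part * G n mu nu
  = \sum_(p \in [set p : intpart * intpart |
                  vstrip p.1 mu /\ subpart p.2 nu])
      G_pieri_coef k p.1 mu nu p.2 *: G n p.1 p.2
  /\
  g n (one_row k) empty_part * g n mu nu
  = \sum_(p \in [set p : intpart * intpart |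
                  hstrip p.1 mu /\ vstrip nu p.2])
      g_pieri_coef k p.1 mu nu p.2 *: g n p.1 p.2.
Proof. by move=> hk; split; [apply: G_pieri | apply: g_pieri]. Qed.
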